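(* Let $R$ be a $\mathbb{Q}$-vector space and $Z \colon \mathcal{I} \rightarrow R$ a $\mathbb{Q}$-linear map satisfying the Ohno-type relation. Extend $Z$ to the $\mathbb{Q}[t]$-linear map $Z \colon \mathcal{I}^t \rightarrow R\otimes\mathbb{Q}[t]$ and set $Z^t \coloneqq Z\circ I^t$. Then, for any admissible index $\boldsymbol{k}$ and any non-negative integer $m$, \begin{align*} Z^{t}\bigl(g_m(\boldsymbol{k};t)\bigr) =\sum_{\substack{\mathrm{wt} (\boldsymbol{e})=m \\ \mathrm{dep} (\boldsymbol{e})=\mathrm{dep} (\boldsymbol{k}^{\dagger})}} Z^{t}\bigl((\boldsymbol{k}^{\dagger}\oplus\boldsymbol{e})^{\dagger}\bigr), \end{align*} where $\boldsymbol{e}$ runs over tuples of non-negative integers.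
   Context: For a tuple of non-negative integers $\boldsymbol{e}=(e_1,\dots,e_r)$, $\mathrm{wt}(\boldsymbol{e})=e_1+\cdots+e_r$ and $\mathrm{dep}(\boldsymbol{e})=r$. An index is a tuple of positive integers (the empty index $\varnothing$ has depth 0); an index $(k_1,\dots,k_r)$ is admissible if $r\ge1$ and $k_r\ge2$, or it is $\varnothing$. For $\boldsymbol{k}=(k_1,\dots,k_r)$ and $\boldsymbol{e}=(e_1,\dots,e_r)$, $\boldsymbol{k}\oplus\boldsymbol{e}=(k_1+e_1,\dots,k_r+e_r)$ and $\varnothing\oplus\varnothing=\varnothing$. For an admissible index written as $\boldsymbol{k}=(\{1\}^{a_1-1}, b_1+1, \ldots, \{1\}^{a_s-1}, b_s+1)$ with $a_p,b_q\ge1$, the dual index is $\boldsymbol{k}^{\dagger}=(\{1\}^{b_s-1}, a_s+1, \ldots, \{1\}^{b_1-1}, a_1+1)$, and $\varnothing^\dagger=\varnothing$. $\mathcal{I}$ (resp. $\mathcal{I}^t$) is the set of formal $\mathbb{Q}$-linear (resp. $\mathbb{Q}[t]$-linear) sums of indices. A $\mathbb{Q}$-linear map $Z\colon\mathcal{I}\to R$ satisfies the Ohno-type relation if for every admissible index $\boldsymbol{k}$ and every $m\ge0$, $\sum_{\mathrm{wt}(\boldsymbol{e})=m,\ \mathrm{dep}(\boldsymbol{e})=\mathrm{dep}(\boldsymbol{k})} Z(\boldsymbol{k}\oplus\boldsymbol{e}) = \sum_{\mathrm{wt}(\boldsymbol{e})=m,\ \mathrm{dep}(\boldsymbol{e})=\mathrm{dep}(\boldsymbol{k}^\dagger)}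 Z((\boldsymbol{k}^\dagger\oplus\boldsymbol{e})^\dagger)$. $I^t\colon\mathcal{I}^t\to\mathcal{I}^t$ is the $\mathbb{Q}[t]$-linear map with $I^t(\varnothing)=\varnothing$ and $I^t(k_1,\dots,k_r)=\sum t^{(\text{number of `+'})}(k_1\square k_2\square\cdots\square k_r)$, summing over all choices of each $\square$ as a comma or a plus. For integers $k\ge1$, $i,e\ge0$, $f_i(k,e)=\sum_{j=0}^{e}\binom{e-j}{i}\binom{k+e-i-2}{j}t^j(1-t)^{e-i-j}\in\mathbb{Q}[t]$, and $f_i(k,-1)=0$. For a non-empty index $\boldsymbol{k}=(k_1,\dots,k_r)$ and $m\ge0$, with $k'_j=k_j+\delta_{j,1}$, $g_m(\boldsymbol{k};t)=\sum_{l=1}^{r}(-t(1-t))^{r-l}\sum_{\boldsymbol{e}=(e_1,\dots,e_l)\in\mathbb{Z}_{\ge0}^l,\ e_1+\cdots+e_l=m}\ \sum_{1=i_1<\cdots<i_{l+1}=r+1}\prod_{l'=1}^{l}f_{i_{l'+1}-i_{l'}-1}(k'_{i_{l'}}+\cdots+k'_{i_{l'+1}-1},e_{l'})\times\bigl((k_{i_1}+\cdots+k_{i_2-1},\dots,k_{i_l}+\cdots+k_{i_{l+1}-1})\oplus\boldsymbol{e}\bigr)\in\mathcal{I}^t$; also $g_{-1}(\boldsymbol{k};t)=0$ and $g_m(\varnothing;t)=\delta_{m,0}\cdot\varnothing$. *)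

(* Defs.v *)
From HB Require Import structures.
From mathcomp Require Import all_boot all_order all_algebra.
From mathcomp Require Import finmap.
From mathcomp.multinomials Require Import monalg.

Set Implicit Arguments.
Unset Strict Implicit.
Unset Printing Implicit Defensive.

Import GRing.Theory.

Local Open Scope ring_scope.

Definition positive_entries (s : seq nat) : bool := all (leq 1) s.

Record idx : Type := Index {
  index_seq :> seq nat;
  index_pos : positive_entries index_seq
}.

HB.instance Definition _ := [isSub for index_seq].
HB.instance Definition _ := [Choice of idx by <:].

Definition empty_index : idx := @Index [::] isT.

Definition wt (e : seq nat) : nat := sumn e.
Definition dep (e : seq nat) : nat := size e.

Definition admissible (k : idx) : bool :=
  (dep k == 0)%N || (2 <= last 0 k)%N.

(* [zip] truncates to the shorter argument; [oplus] is only used when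
   [dep k = dep e]. *)
Definition oplus_seq (k e : seq nat) : seq nat :=
  [seq (x.1 + x.2)%N | x <- zip k e].

Fact oplus_pos (k : idx) (e : seq nat) : positive_entries (oplus_seq k e).
Proof.
case: k => k /=; elim: k e => [|x k IHk] [|y e] //= /andP[x_gt0 k_pos].
by rewrite /positive_entries /= addn_gt0 x_gt0; apply: IHk.
Qed.

Definition oplus (k : idx) (e : seq nat) : idx := Index (oplus_pos k e).

(* The tuples of [r] non-negative integers of weight [m], each listed once:
   see [mem_weak_compositions] and [weak_compositions_uniq]. *)
Fixpoint weak_compositions (r m : nat) : seq (seq nat) :=
  if r is r'.+1 then
    [seq x :: e | x <- iota 0 m.+1, e <- weak_compositions r' (m - x)]
  else if m is 0 then [:: [::]] else [::].

Lemma mem_weak_compositions (r m : nat) (e : seq nat) :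
  (e \in weak_compositions r m) = (dep e == r) && (wt e == m).
Proof.
elim: r m e => [|r IHr] m e; first by case: m; case: e.
apply/allpairsPdep/idP => [[x [e' [x_in e'_in ->]]]|].
  move: x_in e'_in; rewrite mem_iota add0n ltnS IHr /dep /wt /= eqSS.
  by move=> le_xm /andP[-> /eqP ->]; rewrite subnKC /=.
case: e => [|y e] //; rewrite /dep /wt /= eqSS => /andP[de /eqP <-].
exists y, e; split=> //; last by rewrite IHr /dep /wt de addKn eqxx.
by rewrite -[_ :: _]/(iota 0 _.+1) mem_iota add0n ltnS leq_addr.
Qed.

Lemma weak_compositions_uniq (r m : nat) : uniq (weak_compositions r m).
Proof.
elim: r m => [|r IHr] m; first by case: m.
apply: allpairs_uniq_dep; rewrite ?iota_uniq //.
by move=> [x e] [y e'] _ _ /= [-> ->].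
Qed.

(* [ab_index [:: (a_1, b_1); ...; (a_s, b_s)]] is the tuple
   ({1}^(a_1 - 1), b_1 + 1, ..., {1}^(a_s - 1), b_s + 1), and [index_ab] reads
   the pairs off an admissible index.  The two are mutually inverse, see
   [index_abK] and [ab_indexK]. *)
Definition ab_index (ab : seq (nat * nat)) : seq nat :=
  flatten [seq rcons (nseq x.1.-1 1%N) x.2.+1 | x <- ab].

Fixpoint index_ab_from (a : nat) (k : seq nat) : seq (nat * nat) :=
  if k is x :: k' then
    if x == 1%N then index_ab_from a.+1 k'
    else (a, x.-1) :: index_ab_from 1 k'
  else [::].

Definition index_ab (k : seq nat) : seq (nat * nat) := index_ab_from 1 k.

Fact ab_index_pos (ab : seq (nat * nat)) : positive_entries (ab_index ab).
Proof.
elim: ab => [|[a b] ab IHab] //; rewrite /ab_index /= /positive_entries all_cat.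
by rewrite -[X in _ && X]/(positive_entries (ab_index ab)) IHab all_rcons all_nseq orbT.
Qed.

(* On a non-admissible index this drops the trailing 1s; [dual] is only used on
   admissible indices. *)
Definition dual (k : idx) : idx :=
  Index (ab_index_pos [seq (x.2, x.1) | x <- rev (index_ab k)]).

Lemma index_abK (k : idx) : admissible k -> ab_index (index_ab k) = k.
Proof.
case: k => k k_pos; rewrite /admissible /=.
suff H a : (0 < a)%N -> positive_entries k -> (dep k == 0)%N || (2 <= last 0 k)%N ->
    ab_index (index_ab_from a k) = if k is [::] then [::] else nseq a.-1 1%N ++ k.
  by move=> /(H 1%N isT k_pos); rewrite /index_ab => ->; case: k {H k_pos}.
elim: k a {k_pos} => [|x k IHk] //= a a_gt0 /andP[x_gt0 k_pos] k_adm.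
have k_adm' : (dep k == 0)%N || (2 <= last 0 k)%N by case: k k_adm {IHk k_pos}.
have [x1|x_neq1] := eqVneq x 1%N.
  rewrite IHk //= {}x1 in k_adm *; case: k k_adm {IHk k_pos k_adm'} => // y k _.
  by case: a a_gt0 => // a _ /=; elim: a => //= a ->.
rewrite /ab_index /= -/(ab_index _) IHk //= prednK // cat_rcons.
by case: (k).
Qed.

Lemma ab_indexK (ab : seq (nat * nat)) :
  all (fun x => (0 < x.1) && (0 < x.2))%N ab -> index_ab (ab_index ab) = ab.
Proof.
rewrite /index_ab; elim: ab => [|[a b] ab IHab] //= /andP[/andP[a_gt0 b_gt0] /IHab {}IHab].
rewrite /ab_index /= -/(ab_index _) cat_rcons.
have H c n : index_ab_from c (nseq n 1%N ++ b.+1 :: ab_index ab) = ((c + n)%N, b) :: ab.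
  elim: n c => [|n IHn] c /=; last by rewrite IHn addnS.
  by rewrite eqSS eqn0Ngt b_gt0 addn0 IHab.
by rewrite H add1n prednK.
Qed.

Lemma index_ab_pos (k : idx) :
  all (fun x => (0 < x.1) && (0 < x.2))%N (index_ab k).
Proof.
case: k => k /= k_pos; rewrite /index_ab.
suff H a : (0 < a)%N -> all (fun x => (0 < x.1) && (0 < x.2))%N (index_ab_from a k).
  exact: H.
elim: k a k_pos => [|x k IHk] //= a /andP[x_gt0 k_pos] a_gt0.
case: eqVneq => [_|x_neq1] /=; first exact: IHk.
by rewrite a_gt0 IHk // andbT; case: x x_gt0 x_neq1 => [|[|x]].
Qed.

Definition Isp := {malg rat[idx]}.
Definition Ispt := {malg {poly rat}[idx]}.

HB.instance Definition _ := GRing.Lmodule.on Isp.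
HB.instance Definition _ := GRing.Lmodule.on Ispt.

Definition basis (k : idx) : Isp := << k >>.
Definition basist (k : idx) : Ispt := << k >>.

Definition ohno_type_relation (R : lmodType rat) (Z : {linear Isp -> R}) : Prop :=
  forall (k : idx) (m : nat), admissible k ->
    \sum_(e <- weak_compositions (dep k) m) Z (basis (oplus k e))
    = \sum_(e <- weak_compositions (dep (dual k)) m)
        Z (basis (dual (oplus (dual k) e))).

(* The linear map on formal sums prescribed by its values on the generators. *)
Section LinearExtension.
Variables (A : nzRingType) (K : choiceType) (V : lmodType A) (h : K -> V).

Definition linear_extension (x : {malg A[K]}) : V :=
  \sum_(k <- msupp x) x@_k *: h k.

Lemma linear_extensionEw (d : {fset K}) (x : {malg A[K]}) :
  (msupp x `<=` d)%fset -> linear_extension x = \sum_(k <- d) x@_k *: h k.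
Proof.
move=> le_xd; apply: big_fset_incl => // k _ /mcoeff_outdom ->.
exact: scale0r.
Qed.

Lemma linear_extension_is_linear : linear linear_extension.
Proof.
move=> c x y; pose d := (msupp x `|` msupp y)%fset.
rewrite (@linear_extensionEw d (c *: x + y)); last first.
  apply: fsubset_trans (msuppD_le _ _) _.
  exact: fsetUSS (msuppZ_le _ _) (fsubset_refl _).
rewrite (@linear_extensionEw d x) ?fsubsetUl //.
rewrite (@linear_extensionEw d y) ?fsubsetUr //.
rewrite scaler_sumr -big_split /=; apply: eq_bigr => k _.
by rewrite mcoeffD mcoeffZ scalerDl scalerA.
Qed.

HB.instance Definition _ := GRing.isLinear.Build A {malg A[K]} V *:%R
  linear_extension linear_extension_is_linear.

Lemma linear_extensionU (k : K) : linear_extension << k >> = h k.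
Proof.
by rewrite (@linear_extensionEw [fset k]%fset) ?msuppU_le // big_seq_fset1 mcoeffUU scale1r.
Qed.
End LinearExtension.

(* R (x) Q[t], realised as R[t]: [{malg R[nat]}] is the group of finitely
   supported coefficient families, and << r *g n >> is r (x) t^n.
   [tensor_poly_universal] is the universal property of the tensor product. *)
Definition tensor_poly (R : lmodType rat) : Type := {malg R[nat]}.

HB.instance Definition _ (R : lmodType rat) := GRing.Zmodule.on (tensor_poly R).

Section TensorPoly.
Variable R : lmodType rat.
Implicit Types (p q : {poly rat}) (x y : tensor_poly R).

Definition monom (r : R) (n : nat) : tensor_poly R := << r *g n >>.

Definition tensor_poly_scale p x : tensor_poly R :=
  \sum_(i < size p) \sum_(j <- msupp x) monom (p`_i *: x@_j) (i + j).

Local Notation "p *:t x" := (tensor_poly_scale p x) (at level 40).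

Lemma monom0 n : monom 0 n = 0. Proof. exact: monalgU0. Qed.
Lemma monomD n r s : monom (r + s) n = monom r n + monom s n.
Proof. exact: monalgUD. Qed.

Lemma tensor_polyE x : x = \sum_(j <- msupp x) monom x@_j j.
Proof. exact: monalgE. Qed.

Lemma tensor_poly_scaleEw n (d : {fset nat}) p x :
  (size p <= n)%N -> (msupp x `<=` d)%fset ->
  p *:t x = \sum_(i < n) \sum_(j <- d) monom (p`_i *: x@_j) (i + j).
Proof.
move=> le_pn le_xd; rewrite /tensor_poly_scale.
rewrite (big_ord_widen n (fun i => \sum_(j <- msupp x) monom (p`_i *: x@_j) (i + j))) //.
rewrite big_mkcond /=; apply: eq_bigr => i _; case: ltnP => [_|le_pi].
  apply: big_fset_incl => // j _ /mcoeff_outdom ->.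
  by rewrite scaler0 monom0.
by rewrite big1 // => j _; rewrite nth_default // scale0r monom0.
Qed.

Lemma tensor_poly_scaleDl x : {morph (fun p => p *:t x) : p q / p + q}.
Proof.
move=> p q; pose n := maxn (size p) (size q).
have le1 : (size p <= n)%N by rewrite leq_maxl.
have le2 : (size q <= n)%N by rewrite leq_maxr.
have le3 : (size (p + q)%R <= n)%N by rewrite size_polyD.
rewrite !(@tensor_poly_scaleEw n (msupp x)) ?fsubset_refl // -big_split /=.
apply: eq_bigr => i _; rewrite -big_split /=; apply: eq_bigr => j _.
by rewrite coefD scalerDl monomD.
Qed.

Lemma tensor_poly_scaleDr p : {morph tensor_poly_scale p : x y / x + y}.
Proof.
move=> x y; pose d := (msupp x `|` msupp y)%fset.
rewrite (@tensor_poly_scaleEw (size p) d p (x + y)) ?msuppD_le //.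
rewrite (@tensor_poly_scaleEw (size p) d p x) ?fsubsetUl //.
rewrite (@tensor_poly_scaleEw (size p) d p y) ?fsubsetUr //.
rewrite -big_split /=; apply: eq_bigr => i _.
rewrite -big_split /=; apply: eq_bigr => j _.
by rewrite mcoeffD scalerDr monomD.
Qed.

Lemma tensor_poly_scale0l x : 0 *:t x = 0.
Proof. by rewrite /tensor_poly_scale size_poly0 big_ord0. Qed.

Lemma tensor_poly_scale0r p : p *:t 0 = 0.
Proof.
by rewrite /tensor_poly_scale big1 // => i _; rewrite msupp0 big_seq_fset0.
Qed.

Lemma tensor_poly_scale_monom p r n :
  p *:t monom r n = \sum_(i < size p) monom (p`_i *: r) (i + n).
Proof.
rewrite (@tensor_poly_scaleEw (size p) [fset n]%fset) ?msuppU_le //.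
by apply: eq_bigr => i _; rewrite big_seq_fset1 mcoeffUU.
Qed.

Lemma tensor_poly_scaleXn c m r n :
  (c *: 'X^m) *:t monom r n = monom (c *: r) (m + n).
Proof.
rewrite (@tensor_poly_scaleEw m.+1 [fset n]%fset) ?msuppU_le //; last first.
  by rewrite (leq_trans (size_scale_leq _ _)) // size_polyXn.
rewrite big_ord_recr /= big1 => [|i _]; last first.
  by rewrite big_seq_fset1 coefZ coefXn ltn_eqF // mulr0 scale0r monom0.
by rewrite big_seq_fset1 add0r coefZ coefXn eqxx mulr1 mcoeffUU.
Qed.

Lemma tensor_poly_scale_suml (I : Type) (s : seq I) (F : I -> {poly rat}) x :
  (\sum_(i <- s) F i) *:t x = \sum_(i <- s) F i *:t x.
Proof.
exact: (big_morph _ (tensor_poly_scaleDl x) (tensor_poly_scale0l x)).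
Qed.

Lemma tensor_poly_scale_sumr (I : Type) (s : seq I) (F : I -> tensor_poly R) p :
  p *:t (\sum_(i <- s) F i) = \sum_(i <- s) p *:t F i.
Proof.
exact: (big_morph _ (tensor_poly_scaleDr p) (tensor_poly_scale0r p)).
Qed.

Lemma tensor_poly_scaleA p q x : p *:t (q *:t x) = (p * q) *:t x.
Proof.
rewrite (tensor_polyE x) !tensor_poly_scale_sumr; apply: eq_bigr => j _.
move: (x@_j) => r; rewrite -[p]coefK -[q]coefK !poly_def.
rewrite big_distrl /= !tensor_poly_scale_suml; apply: eq_bigr => a _.
rewrite big_distrr /= tensor_poly_scale_suml tensor_poly_scale_sumr.
apply: eq_bigr => b _.
rewrite -scalerAl -scalerAr scalerA -exprD !tensor_poly_scaleXn.
by rewrite scalerA addnA.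
Qed.

Lemma tensor_poly_scale1 x : 1 *:t x = x.
Proof.
rewrite [in RHS](tensor_polyE x) {1}(tensor_polyE x) tensor_poly_scale_sumr.
apply: eq_bigr => j _; have -> : 1 = 1 *: 'X^0 :> {poly rat} by rewrite scale1r expr0.
by rewrite tensor_poly_scaleXn scale1r.
Qed.

HB.instance Definition _ := GRing.Zmodule_isLmodule.Build {poly rat}
  (tensor_poly R) tensor_poly_scaleA tensor_poly_scale1 tensor_poly_scaleDr
  tensor_poly_scaleDl.

Definition tensor (r : R) (p : {poly rat}) : tensor_poly R := p *: monom r 0.

Lemma tensorDl p r s : tensor (r + s) p = tensor r p + tensor s p.
Proof. by rewrite /tensor monomD scalerDr. Qed.

Lemma tensorDr r p q : tensor r (p + q) = tensor r p + tensor r q.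
Proof. by rewrite /tensor scalerDl. Qed.

Lemma tensorZl c r p : tensor (c *: r) p = c%:P *: tensor r p.
Proof.
rewrite /tensor scalerA mulrC -scalerA; congr (_ *: _).
have -> : c%:P = c *: 'X^0 :> {poly rat} by rewrite expr0 alg_polyC.
by rewrite [RHS]tensor_poly_scaleXn.
Qed.

Lemma tensorZr c r p : tensor r (c *: p) = c%:P *: tensor r p.
Proof. by rewrite /tensor scalerA mul_polyC. Qed.

Lemma tensor_poly_universal (W : lmodType rat) (B : R -> {poly rat} -> W) :
  (forall p, linear (B^~ p)) -> (forall r, linear (B r)) ->
  exists2 H : tensor_poly R -> W,
    [/\ {morph H : x y / x + y}, forall c x, H (c%:P *: x) = c *: H x
      & forall r p, H (tensor r p) = B r p]
  & forall H' : tensor_poly R -> W,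
      {morph H' : x y / x + y} -> (forall r p, H' (tensor r p) = B r p) ->
      H' =1 H.
Proof.
move=> Bl Br.
have Bl0 p : B 0 p = 0.
  by have := Bl p (-1) 0 0; rewrite scaler0 addr0 scaleN1r addNr.
have BlD p r s : B (r + s) p = B r p + B s p.
  by have := Bl p 1 r s; rewrite !scale1r.
have BlZ p c r : B (c *: r) p = c *: B r p.
  by have := Bl p c r 0; rewrite !addr0 Bl0 addr0.
have Br0 r : B r 0 = 0.
  by have := Br r (-1) 0 0; rewrite scaler0 addr0 scaleN1r addNr.
have BrD r p q : B r (p + q) = B r p + B r q.
  by have := Br r 1 p q; rewrite !scale1r.
have BrZ r c p : B r (c *: p) = c *: B r p.
  by have := Br r c p 0; rewrite !addr0 Br0 addr0.
pose H (x : tensor_poly R) : W := \sum_(j <- msupp x) B x@_j 'X^j.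
have Hw (d : {fset nat}) x : (msupp x `<=` d)%fset -> H x = \sum_(j <- d) B x@_j 'X^j.
  by move=> le_xd; apply: big_fset_incl => // j _ /mcoeff_outdom ->; rewrite Bl0.
have HD : {morph H : x y / x + y}.
  move=> x y; pose d := (msupp x `|` msupp y)%fset.
  rewrite (@Hw d (x + y)) ?msuppD_le // (@Hw d x) ?fsubsetUl //.
  rewrite (@Hw d y) ?fsubsetUr // -big_split /=; apply: eq_bigr => j _.
  by rewrite mcoeffD BlD.
have H0 : H 0 = 0 by rewrite /H msupp0 big_seq_fset0.
have Hmonom r n : H (monom r n) = B r 'X^n.
  by rewrite (@Hw [fset n]%fset) ?msuppU_le // big_seq_fset1 mcoeffUU.
have Hsum (I : Type) (s : seq I) (F : I -> tensor_poly R) :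
    H (\sum_(i <- s) F i) = \sum_(i <- s) H (F i).
  exact: (big_morph _ HD H0).
have monomE r n : monom r n = tensor r 'X^n.
  rewrite /tensor -['X^n]scale1r [RHS]tensor_poly_scaleXn.
  by rewrite scale1r addn0.
have HZ c x : H (c%:P *: x) = c *: H x.
  rewrite (tensor_polyE x) scaler_sumr !Hsum scaler_sumr; apply: eq_bigr => j _.
  by rewrite monomE -tensorZl -!monomE !Hmonom BlZ.
have HB r p : H (tensor r p) = B r p.
  rewrite /tensor [_ *: _]tensor_poly_scale_monom Hsum -[in RHS](coefK p) poly_def.
  rewrite (big_morph _ (BrD r) (Br0 r)); apply: eq_bigr => i _.
  by rewrite Hmonom addn0 BlZ BrZ.
exists H => [//|H' H'D H'B x].
have H'0 : H' 0 = 0 by apply: (addrI (H' 0)); rewrite -H'D !addr0.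
rewrite [in LHS](tensor_polyE x) (big_morph _ H'D H'0).
by apply: eq_bigr => j _; rewrite monomE H'B.
Qed.

End TensorPoly.

(* [contract k s] turns the i-th comma of [k] into a plus when the i-th entry of
   [s] is [true]. *)
Fixpoint contract_from (x : nat) (k : seq nat) (s : bitseq) : seq nat :=
  match k, s with
  | y :: k', b :: s' =>
      if b then contract_from (x + y) k' s' else x :: contract_from y k' s'
  | _, _ => x :: k
  end.

Definition contract_seq (k : seq nat) (s : bitseq) : seq nat :=
  if k is x :: k' then contract_from x k' s else [::].

Fact contract_pos (k : idx) (s : bitseq) : positive_entries (contract_seq k s).
Proof.
case: k => [[|x k] //=]; rewrite /positive_entries.
elim: k x s => [|y k IHk] x [|b s] //= /and3P[x_gt0 y_gt0 k_pos].
case: b => /=; last by rewrite x_gt0 IHk //= y_gt0.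
by apply: IHk; rewrite /= addn_gt0 x_gt0.
Qed.

Definition contract (k : idx) (s : bitseq) : idx := Index (contract_pos k s).

(* For k = empty_index the sum has the single term s = [::], whence
   [It_empty]. *)
Definition It_index (k : idx) : Ispt :=
  \sum_(s : (dep k).-1.-tuple bool) 'X^(count id s) *: basist (contract k s).

Definition It : Ispt -> Ispt := linear_extension It_index.

Lemma It_empty : It (basist empty_index) = basist empty_index.
Proof.
rewrite /It linear_extensionU /It_index /= (big_pred1 [tuple]) => [|s].
  by rewrite expr0 scale1r; congr basist; apply: val_inj.
by rewrite /= [s]tuple0; apply/esym/eqP.
Qed.

(* Truncated subtraction agrees with the integer formula.  If i > e - j the first
   binomial vanishes.  Otherwise e - i - j >= 0 and k + e - i - 2 >= j - 1, which
   is negative only if it is -1 and j = 0, when the second binomial is 1. *)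
Definition f_coef (i k e : nat) : {poly rat} :=
  \sum_(0 <= j < e.+1)
    ('C(e - j, i) * 'C(k + e - i - 2, j))%:R *: ('X^j * (1 - 'X) ^+ (e - i - j)).

(* Cut points are numbered from 0: [c] stands for (i_1 - 1, ..., i_(l+1) - 1). *)
Definition is_cuts (r : nat) (c : seq nat) : bool :=
  [&& head 0 c == 0, last 0 c == r & sorted ltn c]%N.

Definition block_sum (k c : seq nat) (p : nat) : nat :=
  (\sum_(nth 0 c p <= j < nth 0 c p.+1) nth 0 k j)%N.

Definition block_sums (k c : seq nat) : seq nat :=
  [seq block_sum k c p | p <- iota 0 (size c).-1].

Lemma block_sums_pos (k : idx) (c : seq nat) :
  is_cuts (dep k) c -> positive_entries (block_sums k c).
Proof.
case: k => k k_pos /and3P[_ /eqP c_last c_sorted].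
apply/allP => _ /mapP[p p_in ->]; move: p_in; rewrite mem_iota add0n /= => lt_p.
have lt_p1 : (p.+1 < size c)%N by case: c lt_p {c_last c_sorted} => //=.
have lt_c : (nth 0 c p < nth 0 c p.+1)%N.
  by apply: (sorted_ltn_nth ltn_trans 0%N c_sorted); rewrite ?inE // (ltn_trans _ lt_p1).
have le_ck : (nth 0 c p.+1 <= size k)%N.
  rewrite -[size k]/(dep k) -c_last -nth_last.
  have c_leq : sorted leq c by apply: sub_sorted c_sorted => x y /ltnW.
  apply: (sorted_leq_nth leq_trans leqnn 0%N c_leq); rewrite ?inE //.
  by case: (size c) lt_p1.
rewrite /block_sum big_ltn // addn_gt0 (allP k_pos) //.
by rewrite mem_nth // (leq_trans lt_c).
Qed.

Definition shift_first (k : seq nat) : seq nat :=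
  if k is x :: k' then x.+1 :: k' else [::].

(* [insubd] never defaults below, by [block_sums_pos]. *)
Definition g_sum (m : nat) (k : idx) : Ispt :=
  if dep k is 0 then (m == 0%N)%:R *: basist empty_index else
  \sum_(1 <= l < (dep k).+1)
    (- ('X * (1 - 'X))) ^+ (dep k - l) *:
    \sum_(e <- weak_compositions l m)
    \sum_(c : l.+1.-tuple 'I_(dep k).+1 | is_cuts (dep k) (map val c))
      (\prod_(0 <= p < l)
         f_coef (nth 0%N (map val c) p.+1 - nth 0%N (map val c) p - 1)
           (block_sum (shift_first k) (map val c) p)
           (nth 0%N e p))
      *: basist (oplus (insubd empty_index (block_sums k (map val c))) e).

Section ZExtension.
Variables (R : lmodType rat) (Z : {linear Isp -> R}).

Definition Z_extension : Ispt -> tensor_poly R :=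
  linear_extension (fun k => tensor (Z (basis k)) 1).

Definition Zt : Ispt -> tensor_poly R := Z_extension \o It.
End ZExtension.

(* Main.v *)
Require Import Defs.
From HB Require Import structures.
From mathcomp Require Import all_boot all_order all_algebra.
From mathcomp Require Import qpoly finmap zify ring.
From mathcomp.multinomials Require Import monalg.

(* Encode an index k as the word y x^(k_1 - 1) ... y x^(k_r - 1) and work in the
   free algebra on x, y over Q[t][u]/(u^(N+1)).  Put P = 1/(1 - ux),
   Q = 1/(1 - tux), and consider the algebra endomorphisms
     rho : x -> x,               y -> y P
     phi : x -> (1 - uy)^-1 x,   y -> y
     gam : x -> x,               y -> y + t x
     alp : x -> Q x,             y -> y + t (1 - uy) x
     bet : x -> Q x,             y -> y (1 - tux) P - t (1 - t) u x^2 P.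
   On words y w the generating functions in u of the two sides of the Ohno-type
   relation are rho and phi (phi is the conjugate of rho by the duality
   antiautomorphism), and I^t is y w -> y gam(w).  Expanding bet block by block
   shows that the generating function of g_m is y P bet(w).  Comparing images of
   the letters gives rho alp = gam bet and phi alp = gam phi.  Hence I^t sends
   y P bet(w) to y P rho(alp(w)) = rho(y alp(w)), which Z identifies with
   phi(y alp(w)) = y gam(phi(w)), the image under I^t of y phi(w). *)

Set Implicit Arguments.
Unset Strict Implicit.
Unset Printing Implicit Defensive.

Import GRing.Theory.

Local Open Scope ring_scope.


(** * The coefficients of g_m *)

(** Making the top [M] of the second binomial independent of [i] and [e] lets Pascal's rule be
    applied to either binomial separately. *)
Definition f_binom (i M e : nat) : {poly rat} :=
  \sum_(0 <= j < e.+1)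
    ('C(e - j, i) * 'C(M, j))%:R *: ('X^j * (1 - 'X) ^+ (e - i - j)).

Lemma f_coefE i k e : f_coef i k e = f_binom i (k + e - i - 2) e.
Proof. by []. Qed.

Lemma f_binom0 i M : f_binom i M 0 = (i == 0%N)%:R.
Proof.
rewrite /f_binom big_nat1 bin0 muln1 bin0n mul1r.
by case: i => [|i]; rewrite ?scale0r ?scale1r ?expr0.
Qed.

(** Pascal's rule on the second binomial: its term with [j] lowered by one releases a factor t. *)
Lemma f_binomMS i M e : f_binom i M.+1 e.+1 = f_binom i M e.+1 + 'X * f_binom i M e.
Proof.
rewrite /f_binom !(big_nat_recl e.+1) //= !bin0 -addrA; congr (_ + _).
rewrite mulr_sumr -big_split; apply: eq_bigr => j _ /=.
rewrite binS mulnDr natrD scalerDl; congr (_ + _); rewrite -scalerAr subSS.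
have [lt_ej|le_ie] := ltnP (e - j) i; first by rewrite bin_small // mul0n !scale0r.
by rewrite exprS mulrA subnAC subSS subnAC.
Qed.

(** By [f_binomMS] it remains to write the sum at (i + 1, M, e + 1) as 1 - t times the one at (i +
    1, M, e) plus the one at (i, M, e). This is Pascal's rule on the first binomial. *)
Lemma f_binomSS i M e : f_binom i.+1 M.+1 e.+1 = f_binom i.+1 M e + f_binom i M e.
Proof.
have splitX (q : {poly rat}) : q = (1 - 'X) * q + 'X * q by ring.
rewrite [f_binom i.+1 M e]splitX f_binomMS addrAC; congr (_ + _).
(* The last term, j = e + 1, vanishes because its first binomial is C(0, i + 1). *)
rewrite /f_binom big_nat_recr //= subnn mul0n scale0r addr0.
rewrite mulr_sumr -big_split; apply: eq_big_nat => j /andP[_ le_je] /=.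
rewrite subSn // binS mulnDl natrD scalerDl subSS; congr (_ + _).
rewrite -scalerAr.
have [lt_ej|lt_ie] := ltnP (e - j) i.+1; first by rewrite bin_small // mul0n !scale0r.
by rewrite mulrCA -exprS; congr (_ *: (_ * _ ^+ _)); lia.
Qed.

Lemma f_coef0 i k : f_coef i k 0 = (i == 0%N)%:R.
Proof. exact: f_binom0. Qed.

(** The second binomial is C(e, j), so the sum is 1 - t times the expansion of ((1 - t) + t)^e =
    1. *)
Lemma f_coef_0_1 e : f_coef 0 1 e.+1 = 1 - 'X.
Proof.
have -> : f_coef 0 1 e.+1 = (1 - 'X) * f_coef 0 2 e.
  rewrite !f_coefE /f_binom big_nat_recr //= [X in (_ * X)%N]bin_small; last by lia.
  rewrite muln0 scale0r addr0 mulr_sumr; apply: eq_big_nat => j /andP[_ le_je].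
  rewrite !bin0 -scalerAr (_ : 1 + e.+1 - 0 - 2 = 2 + e - 0 - 2)%N; last by lia.
  congr (_ *: _); by rewrite mulrCA -exprS; congr (_ * _ ^+ _); lia.
rewrite -[RHS]mulr1; congr (_ * _); rewrite f_coefE /f_binom.
rewrite -[RHS](expr1n _ e) -[X in _ = X ^+ e](subrK 'X) exprDn big_mkord.
apply: eq_bigr => j _; rewrite bin0 mul1n scaler_nat mulrC subn0.
by have -> : (2 + e - 0 - 2 = e)%N by lia.
Qed.

(** The bound [i < k] keeps the truncated subtraction exact, so that [f_binomMS] applies. *)
Lemma f_coef_weightS i k e : (i < k)%N ->
  f_coef i k.+1 e.+1 = f_coef i k e.+1 + 'X * f_coef i k.+1 e.
Proof.
move=> lt_ik; rewrite !f_coefE.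
have -> : (k.+1 + e.+1 - i - 2 = (k.+1 + e - i - 2).+1)%N by lia.
by rewrite f_binomMS; congr (f_binom _ _ _ + _); lia.
Qed.

Lemma f_coef_indexS i k e : (i < k)%N ->
  f_coef i.+1 k.+1 e.+1 = f_coef i.+1 k.+1 e + f_coef i k e.
Proof.
move=> lt_ik; rewrite !f_coefE.
have [gt0|le0] := ltnP 0 (k + e - i - 1).
  have -> : (k.+1 + e.+1 - i.+1 - 2 = (k + e - i - 2).+1)%N by lia.
  by rewrite f_binomSS; congr (f_binom _ _ _ + _); lia.
have -> : e = 0%N by lia.
have -> : (k.+1 + 1 - i.+1 - 2 = 0)%N by lia.
rewrite !f_binom0 add0r /f_binom big_mkord !big_ord_recl big_ord0 /= addr0 muln0 scale0r addr0.
by case: i {lt_ik le0} => [|i]; rewrite ?bin0n //= ?scale0r ?scale1r // !expr0 mulr1.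
Qed.

(** * Geometric series of nilpotent elements and the generating series of the f_i *)

Definition geom (S : nzRingType) (N : nat) (z : S) : S := \sum_(i < N.+1) z ^+ i.

Section Geometric.
Variables (S : nzRingType) (N : nat) (z : S).
Hypothesis z_nil : z ^+ N.+1 = 0.

Lemma geomVl : (1 - z) * geom N z = 1.
Proof. by rewrite /geom -opprB mulNr -subrX1 z_nil sub0r opprK. Qed.

Lemma geomVr : geom N z * (1 - z) = 1.
Proof.
rewrite -[RHS]geomVl; apply: commrB; first exact: commr1.
by rewrite /GRing.comm /geom mulr_suml mulr_sumr; apply: eq_bigr => i _; rewrite -exprS -exprSr.
Qed.

(** The shifted sum keeps its length because its extra top term carries z^(N+1) = 0. Recurrences
    between coefficients thus become identities between series. *)
Lemma nilpotent_sum_shift (c : nat -> S) :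
  \sum_(e < N.+1) c e * z ^+ e = c 0 + (\sum_(e < N.+1) c e.+1 * z ^+ e) * z.
Proof.
rewrite big_ord_recl expr0 mulr1 [in RHS]big_ord_recr /= mulrDl -mulrA -exprSr z_nil.
rewrite mulr0 addr0 mulr_suml; congr (_ + _); apply: eq_bigr => i _.
by rewrite -mulrA -exprSr.
Qed.
End Geometric.

Lemma geom_morph (S T : nzRingType) (f : {rmorphism S -> T}) N z :
  f (geom N z) = geom N (f z).
Proof. by rewrite rmorph_sum; apply: eq_bigr => i _; rewrite rmorphXn. Qed.

Section FSeries.
Variables (S : comNzRingType) (cst : {rmorphism {poly rat} -> S}) (N : nat) (z : S).
Hypothesis z_nil : z ^+ N.+1 = 0.

Local Notation t := (cst 'X).
Local Notation P := (geom N z).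
Local Notation Q := (geom N (t * z)).

(* By [f_series0] and [f_seriesS] this is z^n (1 - z)^(-n-1) (1 - t z)^(n+2-k). *)
Definition f_series (n k : nat) : S := \sum_(e < N.+1) cst (f_coef n k e) * z ^+ e.

Let tz_nil : (t * z) ^+ N.+1 = 0.
Proof. by rewrite exprMn z_nil mulr0. Qed.

(** The coefficients are 1, 1 - t, 1 - t, ..., and 1 + (1 - t) z P = ((1 - z) + (1 - t) z) P. *)
Lemma f_series_0_1 : f_series 0 1 = (1 - t * z) * P.
Proof.
have E : f_series 0 1 = 1 + (1 - t) * P * z.
  rewrite /f_series (nilpotent_sum_shift z_nil (fun e => cst (f_coef 0 1 e))).
  rewrite f_coef0 rmorph1; congr (_ + _ * _).
  rewrite /geom mulr_sumr; apply: eq_bigr => e _.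
  by rewrite f_coef_0_1 rmorphB rmorph1.
by rewrite E -{1}(geomVl z_nil); ring.
Qed.

(** The recurrence [f_coef_weightS] says that 1 - t z carries the series of weight k + 1 to that of
    weight k; [Q] inverts this factor. *)
Lemma f_series_weightS n k : (n < k)%N -> f_series n k.+1 = Q * f_series n k.
Proof.
move=> lt_nk; have E : (1 - t * z) * f_series n k.+1 = f_series n k.
  rewrite mulrBl mul1r {1}/f_series [X in X - _](nilpotent_sum_shift z_nil (fun e => cst (f_coef n k.+1 e))).
  rewrite [RHS](nilpotent_sum_shift z_nil (fun e => cst (f_coef n k e))) !f_coef0.
  rewrite -addrA; congr (_ + _); apply/eqP; rewrite subr_eq; apply/eqP.
  rewrite -mulrA [z * _]mulrC mulrA -mulrDl; congr (_ * z).
  rewrite /f_series mulr_sumr -big_split; apply: eq_bigr => e _ /=.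
  by rewrite f_coef_weightS // rmorphD rmorphM mulrDl mulrA.
by rewrite -E mulrA (geomVr tz_nil) mul1r.
Qed.

(** The recurrence [f_coef_indexS] relates the two series by the factors 1 - z and z; [P] inverts
    the first. *)
Lemma f_series_indexS n k : (n < k)%N -> f_series n.+1 k.+1 = z * P * f_series n k.
Proof.
move=> lt_nk.
have E : (1 - z) * f_series n.+1 k.+1 = z * f_series n k.
  rewrite mulrBl mul1r {1}/f_series [X in X - _](nilpotent_sum_shift z_nil (fun e => cst (f_coef n.+1 k.+1 e))).
  rewrite f_coef0 rmorph0 add0r; apply/eqP; rewrite subr_eq; apply/eqP.
  rewrite mulrC -mulrDr; congr (_ * _).
  rewrite /f_series -big_split; apply: eq_bigr => e _ /=.
  by rewrite f_coef_indexS // rmorphD mulrDl addrC.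
by rewrite mulrAC -E mulrAC geomVl // mul1r.
Qed.

Lemma f_series0 k : f_series 0 k.+1 = (1 - t * z) * P * Q ^+ k.
Proof.
elim: k => [|k IHk]; first by rewrite expr0 mulr1 f_series_0_1.
by rewrite f_series_weightS // IHk exprS; ring.
Qed.

(** This is the effect of appending an entry j + 1 to a block: one step raises index and weight
    together and gives z P, the other j raise the weight only and give Q each. *)
Lemma f_seriesS n k j : (n < k)%N ->
  f_series n.+1 (k + j.+1) = z * P * Q ^+ j * f_series n k.
Proof.
move=> lt_nk; elim: j => [|j IHj].
  by rewrite addn1 f_series_indexS // expr0 mulr1.
by rewrite addnS f_series_weightS; [rewrite IHj exprS; ring | lia].
Qed.
End FSeries.

(** * The free algebra on two letters *)

(* [true] is the letter y and [false] the letter x. *)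
Definition word := seq bool.

HB.instance Definition _ := Choice.on word.

Fact word_cat_nil (v w : word) : v ++ w = [::] -> v = [::] /\ w = [::].
Proof. by case: v. Qed.

HB.instance Definition _ := Choice_isMonomialDef.Build word
  (@catA bool) (@cat0s bool) (@cats0 bool) word_cat_nil.

Definition word_alg (A : comNzRingType) : Type := {malg A[word]}.

HB.instance Definition _ (A : comNzRingType) := GRing.Lalgebra.on (word_alg A).

Fact word_alg_scaleAr (A : comNzRingType) (c : A) (g h : word_alg A) :
  c *: (g * h) = g * (c *: h).
Proof.
have cC : c%:MP * g = g * c%:MP :> {malg A[word]}.
  rewrite malgM_def fgmulUg malgM_def fgmulgU; apply: eq_bigr => w _.
  by rewrite mul1m mulm1 mulrC.
have scaleE (k : word_alg A) : c *: k = (c%:MP : {malg A[word]}) * k.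
  by rewrite mul_malgC.
by rewrite !scaleE !mulrA; congr (_ * _).
Qed.

HB.instance Definition _ (A : comNzRingType) :=
  GRing.Lalgebra_isAlgebra.Build A (word_alg A) (@word_alg_scaleAr A).

Section WordAlgebra.
Variable A : comNzRingType.
Local Notation W := (word_alg A).

Definition word_mon (w : word) : W := << w >>.

Lemma word_algE (h : W) : h = \sum_(w <- msupp h) h@_w *: word_mon w.
Proof.
rewrite {1}[h]monalgE; apply: eq_bigr => w _; apply/malgP => v.
by rewrite mcoeffZ !mcoeffU mulrnAr mulr1.
Qed.

Lemma word_monM (v w : word) : word_mon (v ++ w) = word_mon v * word_mon w.
Proof. by rewrite /word_mon malgM_def fgmulUU mulr1. Qed.

Lemma word_mon_nil : word_mon [::] = 1.
Proof. by []. Qed.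

Lemma word_mon_cons l w : word_mon (l :: w) = word_mon [:: l] * word_mon w.
Proof. exact: (word_monM [:: l] w). Qed.

Lemma eq_additive_word_alg (V : zmodType) (f g : {additive W -> V}) :
  (forall c w, f (c *: word_mon w) = g (c *: word_mon w)) -> f =1 g.
Proof.
by move=> fg h; rewrite (word_algE h) !raddf_sum; apply: eq_bigr => w _.
Qed.

Lemma eq_linear_word_alg (V : lmodType A) (f g : {linear W -> V}) :
  (forall w, f (word_mon w) = g (word_mon w)) -> f =1 g.
Proof.
by move=> fg; apply: eq_additive_word_alg => c w /=; rewrite !linearZ_LR fg.
Qed.

Section Substitution.
Variables (S : algType A) (a : bool -> S).

Definition subst : W -> S := linear_extension (fun w : word => \prod_(l <- w) a l).

HB.instance Definition _ := GRing.Linear.on subst.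

Lemma subst_word w : subst (word_mon w) = \prod_(l <- w) a l.
Proof. exact: linear_extensionU. Qed.

Fact subst_is_monoid_morphism : monoid_morphism subst.
Proof.
split=> [|g h]; first by rewrite -word_mon_nil subst_word big_nil.
rewrite (word_algE g) mulr_suml !linear_sum mulr_suml; apply: eq_bigr => v _.
rewrite -scalerAl !linearZ /= -scalerAl; congr (_ *: _).
rewrite (word_algE h) mulr_sumr !linear_sum mulr_sumr; apply: eq_bigr => w _.
rewrite -scalerAr !linearZ /= -scalerAr; congr (_ *: _).
by rewrite -word_monM !subst_word big_cat.
Qed.

HB.instance Definition _ := GRing.isMonoidMorphism.Build W S subst
  subst_is_monoid_morphism.

Lemma subst_letter l : subst (word_mon [:: l]) = a l.
Proof. by rewrite subst_word big_seq1. Qed.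
End Substitution.

(** Both composites are algebra morphisms, so commutation relations between the endomorphisms need
    only be compared on x and y. *)
Lemma subst_comp (a b c d : bool -> W) :
  (forall l, subst a (b l) = subst c (d l)) ->
  forall h, subst a (subst b h) = subst c (subst d h).
Proof.
move=> abcd h.
apply: (@eq_linear_word_alg _ (subst a \o subst b) (subst c \o subst d)) => w /=.
rewrite !subst_word !rmorph_prod; apply: eq_bigr => l _; exact: abcd.
Qed.
End WordAlgebra.

(** * The endomorphisms and their commutation relations *)

Section Automorphisms.
Variables (A : comNzRingType) (t u : A) (N : nat).
Hypothesis u_nil : u ^+ N.+1 = 0.
Local Notation W := (word_alg A).

Definition letter_x : W := word_mon A [:: false].
Definition letter_y : W := word_mon A [:: true].
Local Notation x := letter_x.
Local Notation y := letter_y.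

Definition geom_x : W := geom N (u *: x).
Definition geom_tx : W := geom N ((t * u) *: x).
Definition geom_y : W := geom N (u *: y).
Local Notation P := geom_x.
Local Notation Q := geom_tx.

Definition rho : W -> W := subst (fun l => if l then y * P else x).
Definition phi : W -> W := subst (fun l => if l then y else geom_y * x).
Definition gam : W -> W := subst (fun l => if l then y + t *: x else x).
Definition alp : W -> W :=
  subst (fun l => if l then y + t *: ((1 - u *: y) * x) else Q * x).
Definition bet : W -> W :=
  subst (fun l => if l then y * ((1 - (t * u) *: x) * P) - (t * (1 - t) * u) *: (x * x * P)
                  else Q * x).

HB.instance Definition _ := GRing.LRMorphism.on rho.
HB.instance Definition _ := GRing.LRMorphism.on phi.
HB.instance Definition _ := GRing.LRMorphism.on gam.
HB.instance Definition _ := GRing.LRMorphism.on alp.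
HB.instance Definition _ := GRing.LRMorphism.on bet.

Lemma rho_x : rho x = x. Proof. exact: subst_letter. Qed.
Lemma rho_y : rho y = y * P. Proof. exact: subst_letter. Qed.
Lemma phi_x : phi x = geom_y * x. Proof. exact: subst_letter. Qed.
Lemma phi_y : phi y = y. Proof. exact: subst_letter. Qed.
Lemma gam_x : gam x = x. Proof. exact: subst_letter. Qed.
Lemma gam_y : gam y = y + t *: x. Proof. exact: subst_letter. Qed.
Lemma alp_x : alp x = Q * x. Proof. exact: subst_letter. Qed.

Lemma scale_nil (c : A) (h : W) : ((c * u) *: h) ^+ N.+1 = 0.
Proof. by rewrite exprZn exprMn u_nil mulr0 scale0r. Qed.

Lemma uscale_nil (h : W) : (u *: h) ^+ N.+1 = 0.
Proof. by rewrite exprZn u_nil scale0r. Qed.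

Local Notation eta := (horner_alg x).

Let z : {poly A} := u *: 'X.

Let z_nil : z ^+ N.+1 = 0.
Proof. by rewrite exprZn u_nil scale0r. Qed.

(** Identities in x alone hold in the image of the commutative ring A[X] under evaluation at x. They
    can be proved there by [ring] and transported; this lemma transports the geometric series. *)
Lemma horner_alg_geom c : horner_alg x (geom N (c *: 'X)) = geom N (c *: x).
Proof. by rewrite geom_morph -mul_polyC rmorphM /= horner_algC horner_algX mulr_algl. Qed.

Lemma gam_geom c : gam (geom N (c *: x)) = geom N (c *: x).
Proof. by rewrite geom_morph /= linearZ_LR /= gam_x. Qed.

Lemma rho_geom c : rho (geom N (c *: x)) = geom N (c *: x).
Proof. by rewrite geom_morph /= linearZ_LR /= rho_x. Qed.

(** Invert both sides of 1 - u y - t u x = (1 - u y) (1 - t u (1 - u y)^-1 x); inversion reverses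
    the order of the factors. *)
Lemma phi_geom_tx : phi Q * geom_y = gam geom_y.
Proof.
have E1 : phi Q * (1 - (t * u) *: (geom_y * x)) = 1.
  have := congr1 phi (geomVr (scale_nil t x)).
  by rewrite rmorphM rmorphB !rmorph1 /= linearZ_LR /= phi_x.
have E2 : (1 - u *: (y + t *: x)) * gam geom_y = 1.
  have := congr1 gam (geomVl (uscale_nil y)).
  by rewrite rmorphM rmorphB !rmorph1 /= linearZ_LR /= gam_y.
have E3 : geom_y * (1 - u *: (y + t *: x)) = 1 - (t * u) *: (geom_y * x).
  rewrite scalerDr scalerA opprD addrA mulrBr (geomVr (uscale_nil y)).
  by rewrite -scalerAr [u * t]mulrC.
by rewrite -[LHS]mulr1 -E2 mulrA -(mulrA (phi Q)) E3 E1 mul1r.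
Qed.

(** On y, the factor 1 - u y built into [alp] cancels the inverse that [phi] puts before x. On x
    this is [phi_geom_tx]. *)
Lemma phi_alp h : phi (alp h) = gam (phi h).
Proof.
apply: subst_comp => -[].
  rewrite -/phi -/gam rmorphD /= linearZ_LR /= rmorphM rmorphB !rmorph1 /= linearZ_LR /=.
  by rewrite phi_x phi_y gam_y mulrA (geomVl (uscale_nil y)) mul1r.
by rewrite -/phi -/gam !rmorphM /= phi_x gam_x mulrA phi_geom_tx.
Qed.

Lemma rho_alp h : rho (alp h) = gam (bet h).
Proof.
apply: subst_comp => -[]; last first.
  by rewrite -/rho -/gam !rmorphM /= rho_x gam_x rho_geom gam_geom.
rewrite -/rho -/gam rmorphD /= [rho (t *: _)]linearZ_LR /= rmorphM /= rmorphB rmorph1 /=.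
rewrite [rho (u *: _)]linearZ_LR /= rho_x rho_y.
rewrite rmorphB /= [gam (_ *: (_ * _))]linearZ_LR /= !rmorphM /= rmorphB rmorph1 /=.
rewrite [gam (_ *: x)]linearZ_LR /= gam_geom gam_x gam_y -/P.
have etaZ c : c *: x = eta (c%:P * 'X) by rewrite rmorphM /= horner_algC horner_algX mulr_algl.
have etaP : P = eta (geom N z) by rewrite horner_alg_geom.
have xP : x * P = P * x.
  by have := congr1 eta (mulrC 'X (geom N z)); rewrite !rmorphM /= horner_algX -etaP.
(* The part of [gam (bet y)] free of y is t x (1 - t u x - (1 - t) u x) P = t x (1 - u x) P = t x.
   The correction term in [bet] is chosen for this. *)
have E : t *: (x * ((1 - (t * u) *: x) * P)) - (t * (1 - t) * u) *: (x * x * P) = t *: x.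
  have -> : t *: (x * ((1 - (t * u) *: x) * P)) - (t * (1 - t) * u) *: (x * x * P)
      = eta (t%:P * ('X * ((1 - (t * u)%:P * 'X) * geom N z))
             - (t * (1 - t) * u)%:P * ('X * 'X * geom N z)).
    move: (t * (1 - t) * u) (t * u) => c d.
    rewrite !(rmorphM, rmorphB, rmorph1) /= !(horner_algC, horner_algX) -etaP.
    by rewrite !mulr_algl.
  rewrite [RHS]etaZ; congr (horner_alg _ _).
  rewrite !(polyCM, polyCB, polyC1) -[RHS]mulr1 -[X in _ = _ * X](geomVl z_nil) /z -mul_polyC; ring.
rewrite [in RHS]mulrDl -[in RHS]addrA -[in RHS]scalerAl E; clear E.
rewrite !mulrBl !mul1r mulrBr scalerBr -!scalerAl -!scalerAr scalerA -mulrA xP mulrA.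
by rewrite [t *: x - _]addrC addrA.
Qed.
End Automorphisms.

(** * The truncated coefficient ring Q[t][u]/(u^(N+1)) *)

Section Truncation.
Variable N : nat.

Local Notation trunc_ring := {poly %/ ('X^(N.+1) : {poly {poly rat}})}.
Local Notation trunc_poly := (in_qpoly ('X^(N.+1) : {poly {poly rat}})).

(* The base ring Q[t][u]/(u^(N+1)): [trunc_const] embeds Q[t] and [trunc_var] is u. *)
Definition trunc_const : {poly rat} -> trunc_ring := trunc_poly \o polyC.
HB.instance Definition _ := GRing.RMorphism.on trunc_const.

Definition trunc_var : trunc_ring := trunc_poly 'X.

Definition trunc_coef (m : nat) (a : trunc_ring) : {poly rat} := (val a)`_m.

Fact trunc_coef_is_zmod_morphism m : zmod_morphism (trunc_coef m).
Proof. by move=> a b; rewrite /trunc_coef /= coefB. Qed.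
HB.instance Definition _ m := GRing.isZmodMorphism.Build trunc_ring {poly rat}
  (trunc_coef m) (trunc_coef_is_zmod_morphism m).

(** Reduction modulo u^(N+1) subtracts a multiple of u^(N+1), which leaves the coefficients up to N
    unchanged. *)
Lemma trunc_coef_poly m p : (m <= N)%N -> trunc_coef m (trunc_poly p) = p`_m.
Proof.
move=> le_mN; rewrite /trunc_coef /= mk_monic_Xn /=.
rewrite [in RHS](Pdiv.RingMonic.rdivp_eq (monicXn _ N.+1) p) coefD coefMXn.
by rewrite ltnS le_mN add0r.
Qed.

Lemma trunc_polyK (a : trunc_ring) : trunc_poly (val a) = a.
Proof. by apply: val_inj; apply: in_qpoly_small; apply: size_mk_monic. Qed.

Lemma trunc_var_nil : trunc_var ^+ N.+1 = 0.
Proof.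
rewrite /trunc_var -rmorphXn; apply: val_inj => /=; rewrite mk_monic_Xn /=.
by rewrite Pdiv.RingMonic.rmodpp // monicXn.
Qed.

Lemma trunc_coef1 m : (m <= N)%N -> trunc_coef m 1 = (m == 0%N)%:R.
Proof. by move=> le_mN; rewrite -(rmorph1 trunc_poly) trunc_coef_poly // coef1. Qed.

(** Together with [trunc_var_nil], [trunc_coef1] and [trunc_expand], this is the interface that
    later sections take as hypotheses on an abstract ring [T]. *)
Lemma trunc_coefM m p j (a : trunc_ring) : (m <= N)%N ->
  trunc_coef m (trunc_const p * trunc_var ^+ j * a)
  = if (j <= m)%N then p * trunc_coef (m - j) a else 0.
Proof.
move=> le_mN.
have -> : trunc_const p * trunc_var ^+ j * a = trunc_poly (p%:P * 'X^j * val a).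
  by rewrite !rmorphM rmorphXn; congr (_ * _); apply/esym/trunc_polyK.
rewrite trunc_coef_poly // -mulrA coefCM coefXnM.
by rewrite ltnNge; case: leqP; rewrite ?mulr0.
Qed.

Lemma trunc_expand (a : trunc_ring) :
  a = \sum_(j < N.+1) trunc_const (trunc_coef j a) * trunc_var ^+ j.
Proof.
rewrite -{1}[a]trunc_polyK.
have sz : (size (val a) <= N.+1)%N.
  by apply: leq_trans (size_npoly a) _; rewrite mk_monic_Xn size_polyXn.
rewrite [X in trunc_poly X](_ : _ = \sum_(j < N.+1) ((val a)`_j)%:P * 'X^j).
  by rewrite rmorph_sum; apply: eq_bigr => j _; rewrite rmorphM rmorphXn.
rewrite -[LHS]coefK poly_def (big_ord_widen _ (fun i => (val a)`_i *: 'X^i) sz).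
rewrite big_mkcond; apply: eq_bigr => i _; rewrite mul_polyC.
by case: ltnP => // le_i; rewrite nth_default ?scale0r.
Qed.
End Truncation.

(** * Indices as words *)

(* [word_blocks c w] reads off the index of y x^(c - 1) w. *)
Fixpoint word_blocks (c : nat) (w : word) : seq nat :=
  if w is l :: w' then
    if l then c :: word_blocks 1 w' else word_blocks c.+1 w'
  else [:: c].

Definition seq_index (s : seq nat) : idx := insubd empty_index s.

(** The leading letter is dropped unread, as it is meant to be y. The empty index is never a value:
    the empty word gives the index (1). *)
Definition word_index (w : word) : idx := seq_index (word_blocks 1 (behead w)).

Definition block_word (x : nat) : word := true :: nseq x.-1 false.

Definition index_word (k : seq nat) : word := flatten [seq block_word x | x <- k].

Lemma seq_index_val (k : idx) : seq_index k = k.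
Proof. exact: valKd. Qed.

Lemma word_blocks_nseq c n w :
  word_blocks c (nseq n false ++ w) = word_blocks (c + n) w.
Proof. by elim: n c => [|n IHn] c /=; rewrite ?addn0 // IHn addSnnS. Qed.

Lemma word_blocksK x k : positive_entries (x :: k) ->
  word_blocks 1 (behead (index_word (x :: k))) = x :: k.
Proof.
rewrite /positive_entries; elim: k x => [|y k IHk] x /= /andP[x_gt0 k_pos].
  by rewrite /index_word /= word_blocks_nseq /= add1n prednK.
rewrite /index_word /= word_blocks_nseq /= add1n prednK //; congr (_ :: _).
exact: IHk.
Qed.

Lemma index_wordK (k : idx) : k != [::] :> seq nat -> word_index (index_word k) = k.
Proof.
case: k => [[|x k] //= k_pos] _; apply: val_inj; rewrite /word_index word_blocksK //.
by rewrite /seq_index insubdK.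
Qed.

Section IndexWord.
Variables (A : comNzRingType) (u : A) (N : nat).
Hypothesis u_nil : u ^+ N.+1 = 0.
Local Notation W := (word_alg A).
Local Notation x := (letter_x A).
Local Notation y := (letter_y A).
Local Notation P := (geom_x u N).

(** The products with i + j > N vanish because u^(N+1) = 0, so the truncated Cauchy product is
    exact. *)
Lemma cauchy_product (a b : nat -> W) :
  (\sum_(i < N.+1) u ^+ i *: a i) * (\sum_(j < N.+1) u ^+ j *: b j)
  = \sum_(m < N.+1) u ^+ m *: \sum_(i <- iota 0 m.+1) a i * b (m - i)%N.
Proof.
rewrite mulr_suml.
under [RHS]eq_bigr => m _.
  rewrite -[iota 0 m.+1]/(index_iota 0 m.+1) big_mkord scaler_sumr.
  rewrite (big_ord_widen N.+1 (fun i => u ^+ m *: (a i * b (m - i)%N))) //.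
  rewrite big_mkcond; over.
rewrite exchange_big; apply: eq_bigr => i _ /=.
rewrite mulr_sumr -[RHS](big_mkord xpredT (fun m => if (i < m.+1)%N then
  u ^+ m *: (a i * b (m - i)%N) else 0)).
rewrite (big_cat_nat (n := i)) //=; last by rewrite ltnW.
rewrite [X in _ = X + _]big1_seq ?add0r => [|m]; last first.
  by rewrite mem_index_iota => /andP[_ /andP[_ lt_mi]]; rewrite ltnS leqNgt lt_mi.
rewrite [in RHS](@big_addn _ _ _ 0 N.+1 i) -(big_mkord xpredT (fun j => u ^+ i *: a i * (u ^+ j *: b j))).
rewrite (big_cat_nat (n := N.+1 - i)) ?leq_subr //= [X in _ + X = _]big1_seq ?addr0.
  apply: eq_bigr => j _.
  by rewrite ltnS leq_addl addnK -scalerAl -scalerAr scalerA -exprD addnC.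
move=> j; rewrite mem_index_iota => /andP[_ /andP[le_j _]]; rewrite -scalerAl -scalerAr scalerA -exprD.
have -> : (i + j = N.+1 + (i + j - N.+1))%N by lia.
by rewrite exprD u_nil mul0r scale0r.
Qed.

Lemma word_mon_nseq_x n : word_mon A (nseq n false) = x ^+ n.
Proof. by elim: n => [|n IHn] //=; rewrite word_mon_cons IHn exprS. Qed.

Lemma word_mon_block k : word_mon A (block_word k) = y * x ^+ k.-1.
Proof. by rewrite /block_word word_mon_cons word_mon_nseq_x. Qed.

Lemma index_word_cons k s : index_word (k :: s) = block_word k ++ index_word s.
Proof. by []. Qed.

(** Since y x^(k-1) (u x)^e = u^e y x^(k+e-1), each block adds e to its entry, and Cauchy products
    gather the tuples e by weight. The lemma serves [rho], with all coefficients 1, and g_m, with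
    the coefficients f. *)
Lemma block_product (bs : seq (nat * (nat -> A))) : all (fun b => 0 < b.1)%N bs ->
  \prod_(b <- bs) (y * x ^+ b.1.-1 * \sum_(e < N.+1) b.2 e *: (u *: x) ^+ e)
  = \sum_(m < N.+1) u ^+ m *: \sum_(e <- weak_compositions (size bs) m)
      (\prod_(be <- zip bs e) be.1.2 be.2) *:
      word_mon A (index_word (oplus_seq (map fst bs) e)).
Proof.
elim: bs => [_|[k c] bs IHbs /andP[/= k_gt0 bs_pos]].
  rewrite big_nil big_ord_recl /= [X in _ + X]big1 => [|i _].
    by rewrite expr0 scale1r big_seq1 big_nil scale1r addr0.
  by rewrite big_nil scaler0.
have Ek : y * x ^+ k.-1 * (\sum_(e < N.+1) c e *: (u *: x) ^+ e)
    = \sum_(e < N.+1) u ^+ e *: (c e *: word_mon A (block_word (k + e))).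
  rewrite mulr_sumr; apply: eq_bigr => e _.
  rewrite word_mon_block exprZn !scalerA -scalerAr mulrC; congr (_ *: _).
  by rewrite -mulrA -exprD; congr (_ * _ ^+ _); lia.
rewrite big_cons IHbs // Ek.
rewrite (cauchy_product (fun e => c e *: word_mon A (block_word (k + e)))
  (fun m => \sum_(e <- weak_compositions (size bs) m)
      (\prod_(be <- zip bs e) be.1.2 be.2) *:
      word_mon A (index_word (oplus_seq (map fst bs) e)))).
apply: eq_bigr => m _; congr (_ *: _).
rewrite -[X in _ = \big[_/_]_(e <- X) _]/[seq x :: e | x <- iota 0 m.+1, e <- weak_compositions (size bs) (m - x)].
rewrite big_allpairs_dep; apply: eq_bigr => i _.
rewrite mulr_sumr; apply: eq_bigr => e _.
by rewrite big_cons index_word_cons word_monM -scalerAl -scalerAr scalerA.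
Qed.

Lemma comm_x_geom n c : x ^+ n * geom N (c *: x) = geom N (c *: x) * x ^+ n.
Proof.
rewrite /geom mulr_sumr mulr_suml; apply: eq_bigr => i _.
by rewrite exprZn -scalerAr -scalerAl -!exprD addnC.
Qed.

Lemma rho_index_word k : positive_entries k ->
  rho u N (word_mon A (index_word k)) =
  \sum_(m < N.+1) u ^+ m *: \sum_(e <- weak_compositions (size k) m)
      word_mon A (index_word (oplus_seq k e)).
Proof.
move=> k_pos; have := @block_product [seq (x, fun=> 1) | x <- k].
rewrite all_map => /(_ k_pos); rewrite size_map -map_comp map_id big_map => E.
transitivity (\prod_(b <- k) (y * x ^+ b.-1 * (\sum_(e < N.+1) 1 *: (u *: x) ^+ e))).
  elim: k {k_pos E} => [|n k IHk]; first by rewrite big_nil /index_word /= rmorph1.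
  rewrite index_word_cons word_monM rmorphM big_cons -IHk; congr (_ * _).
  rewrite word_mon_block rmorphM rmorphXn /= rho_x rho_y -mulrA -comm_x_geom mulrA.
  by congr (_ * _); apply: eq_bigr => i _; rewrite scale1r.
rewrite E; apply: eq_bigr => m _; congr (_ *: _); apply: eq_bigr => e _.
rewrite -[RHS]scale1r; congr (_ *: _).
elim: k e {k_pos E} => [|n k IHk] [|e' e] /=; rewrite ?big_nil //.
by rewrite big_cons mul1r IHk.
Qed.

(* The duality antiautomorphism. *)
Definition tau : W -> W := linear_extension (fun w : word => word_mon A (rev (map negb w))).
HB.instance Definition _ := GRing.Linear.on tau.

Lemma tau_word w : tau (word_mon A w) = word_mon A (rev (map negb w)).
Proof. exact: linear_extensionU. Qed.

Lemma tauM (g h : W) : tau (g * h) = tau h * tau g.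
Proof.
rewrite (word_algE g) mulr_suml !linear_sum mulr_sumr; apply: eq_bigr => v _.
rewrite -scalerAl !linearZ_LR /= -scalerAr; congr (_ *: _).
rewrite (word_algE h) mulr_sumr !linear_sum mulr_suml; apply: eq_bigr => w _.
rewrite -scalerAr !linearZ_LR /= -scalerAl; congr (_ *: _).
by rewrite -word_monM !tau_word map_cat rev_cat word_monM.
Qed.

Lemma tau_x : tau x = y. Proof. exact: tau_word. Qed.
Lemma tau_y : tau y = x. Proof. exact: tau_word. Qed.

Lemma tauX (h : W) n : tau (h ^+ n) = tau h ^+ n.
Proof.
elim: n => [|n IHn]; first by rewrite !expr0 -word_mon_nil tau_word.
by rewrite exprS tauM IHn -exprSr.
Qed.

(** Both composites reverse products, so the letters decide: [tau] carries P to (1 - u y)^-1, hence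
    y P to (1 - u y)^-1 x. *)
Lemma phi_tau h : phi u N (tau h) = tau (rho u N h).
Proof.
have E (w : word) : phi u N (tau (word_mon A w)) = tau (rho u N (word_mon A w)).
  elim: w => [|l w IHw].
    by rewrite word_mon_nil rmorph1 -word_mon_nil tau_word word_mon_nil rmorph1.
  rewrite word_mon_cons tauM !rmorphM /= tauM IHw; congr (_ * _).
  case: l; rewrite -/(letter_x A) -/(letter_y A).
    rewrite tau_y phi_x rho_y tauM tau_y; congr (_ * _).
    rewrite /geom_x /geom linear_sum; apply: eq_bigr => i _.
    by rewrite /= tauX linearZ_LR /= tau_x.
  by rewrite tau_x rho_x phi_y tau_x.
exact: (@eq_linear_word_alg _ _ (phi u N \o tau) (tau \o rho u N) E h).
Qed.
End IndexWord.

(** * From the word algebra to formal sums of indices: coefficients in u *)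

Section CoefficientExtraction.
Variables (N : nat) (T : comNzRingType) (u : T) (cst : {rmorphism {poly rat} -> T})
  (coef : nat -> {additive T -> {poly rat}}).
Hypothesis coef1 : forall m, (m <= N)%N -> coef m 1 = (m == 0%N)%:R.
Hypothesis coefM : forall m p j (a : T), (m <= N)%N ->
  coef m (cst p * u ^+ j * a) = if (j <= m)%N then p * coef (m - j)%N a else 0.
Local Notation W := (word_alg T).

(* [coef m] extracts the coefficient of u^m. *)
Definition word_coef (m : nat) (h : W) : Ispt :=
  \sum_(w <- msupp h) coef m h@_w *: basist (word_index w).

Lemma word_coefEw m (d : {fset word}) (h : W) : (msupp h `<=` d)%fset ->
  word_coef m h = \sum_(w <- d) coef m h@_w *: basist (word_index w).
Proof.
move=> le_hd; apply: big_fset_incl => // k _ /mcoeff_outdom ->.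
by rewrite raddf0 scale0r.
Qed.

Fact word_coef_is_zmod_morphism m : zmod_morphism (word_coef m).
Proof.
move=> g h; pose d := (msupp g `|` msupp h)%fset.
rewrite (@word_coefEw m d (g - h)); last exact: msuppB_le.
rewrite (@word_coefEw m d g) ?fsubsetUl // (@word_coefEw m d h) ?fsubsetUr //.
by rewrite -sumrB; apply: eq_bigr => k _; rewrite mcoeffB raddfB scalerBl.
Qed.

HB.instance Definition _ m := GRing.isZmodMorphism.Build W Ispt
  (word_coef m) (word_coef_is_zmod_morphism m).

Lemma word_coef_mon m c w :
  word_coef m (c *: word_mon T w) = coef m c *: basist (word_index w).
Proof.
rewrite (@word_coefEw m [fset w]%fset); last first.
  by apply: fsubset_trans (msuppZ_le _ _) _; apply: msuppU_le.
by rewrite big_seq_fset1 mcoeffZ mcoeffUU mulr1.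
Qed.

Lemma word_coef_scale m p j h : (m <= N)%N ->
  word_coef m ((cst p * u ^+ j) *: h) =
  if (j <= m)%N then p *: word_coef (m - j) h else 0.
Proof.
move=> le_mN; rewrite {1}(word_algE h) scaler_sumr raddf_sum /=.
under eq_bigr => w _ do rewrite scalerA word_coef_mon coefM //.
case: leqP => _; last by rewrite big1 // => w _; rewrite scale0r.
by rewrite /word_coef scaler_sumr; apply: eq_bigr => w _; rewrite scalerA.
Qed.

(** The elements [cst (p i)] are free of u, so only the summand j = m contributes. *)
Lemma word_coef_series m (I : Type) (r : nat -> seq I) (p : I -> {poly rat}) (w : I -> word) :
  (m <= N)%N ->
  word_coef m (\sum_(j < N.+1) u ^+ j *: \sum_(i <- r j) cst (p i) *: word_mon T (w i))
  = \sum_(i <- r m) p i *: basist (word_index (w i)).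
Proof.
move=> le_mN; rewrite raddf_sum /=.
have E (j : 'I_N.+1) : word_coef m (u ^+ j *: \sum_(i <- r j) cst (p i) *: word_mon T (w i))
    = if j == m :> nat then \sum_(i <- r j) p i *: basist (word_index (w i)) else 0.
  rewrite scaler_sumr raddf_sum /=.
  transitivity (\sum_(i <- r j) (j == m :> nat)%:R *: (p i *: basist (word_index (w i)))).
    apply: eq_bigr => i _; rewrite scalerA word_coef_mon mulrC -[X in coef _ X]mulr1.
    rewrite coefM // scalerA; congr (_ *: _).
    case: leqP => [le_jm|lt_mj]; last by rewrite gtn_eqF ?mul0r.
    rewrite coef1 ?(leq_trans (leq_subr _ _)) // mulrC; congr (_%:R * _).
    by congr nat_of_bool; lia.
  by case: eqP => _; [apply: eq_bigr => i _; rewrite scale1r | rewrite big1 // => i _; rewrite scale0r].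
rewrite (bigD1 (Ordinal (le_mN : (m < N.+1)%N))) // E eqxx /= [X in _ + X]big1 ?addr0 // => j ne_j.
by rewrite E ifN.
Qed.

Lemma word_coef_mons m (I : Type) (r : nat -> seq I) (w : I -> word) : (m <= N)%N ->
  word_coef m (\sum_(j < N.+1) u ^+ j *: \sum_(i <- r j) word_mon T (w i))
  = \sum_(i <- r m) basist (word_index (w i)).
Proof.
move=> le_mN; have := word_coef_series r (fun=> 1) w le_mN.
under eq_bigr => j _ do under eq_bigr => i _ do rewrite rmorph1 scale1r.
by move=> ->; apply: eq_bigr => i _; rewrite scale1r.
Qed.
End CoefficientExtraction.

(** * Contractions, duality and the Ohno-type relation *)

HB.instance Definition _ := GRing.Linear.copy It (linear_extension It_index).

Lemma It_basist k : It (basist k) = It_index k.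
Proof. exact: linear_extensionU. Qed.

Lemma big_tuple_cons (V : zmodType) n (F : bitseq -> V) :
  \sum_(s : n.+1.-tuple bool) F s =
  \sum_(s : n.-tuple bool) F (true :: s) + \sum_(s : n.-tuple bool) F (false :: s).
Proof.
transitivity (\sum_(p : bool * n.-tuple bool) F (p.1 :: p.2)).
  rewrite (reindex (fun p : bool * n.-tuple bool => [tuple of p.1 :: p.2])) //=.
  exists (fun s : n.+1.-tuple bool => (thead s, [tuple of behead s])) => [[b s]|s] _ /=.
    by rewrite theadE; congr (_, _); apply: val_inj.
  by rewrite [RHS](tuple_eta s); apply: val_inj.
rewrite -(pair_bigA _ (fun b (s : n.-tuple bool) => F (b :: s))) /=.
by rewrite big_bool.
Qed.

(* The expansion of a product of letters y + t x and x: [(d, v)] stands for t^d v. *)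
Fixpoint x_expansion (w : word) : seq (nat * word) :=
  if w is l :: w' then
    if l then [seq (p.1, true :: p.2) | p <- x_expansion w'] ++
              [seq (p.1.+1, false :: p.2) | p <- x_expansion w']
    else [seq (p.1, false :: p.2) | p <- x_expansion w']
  else [:: (0%N, [::])].

Definition add_head (c : nat) (k : seq nat) : seq nat :=
  if k is x :: k' then (c + x)%N :: k' else [::].

Lemma contract_from_add_head c x k s :
  contract_from (c + x) k s = add_head c (contract_from x k s).
Proof. by elim: k x s => [|y k IHk] x [|[] s] //=; rewrite -addnA IHk. Qed.

Lemma word_blocksS c w : word_blocks (c + 1) w = add_head c (word_blocks 1 w).
Proof.
suff H d : word_blocks (c + d) w = add_head c (word_blocks d w) by exact: H.
by elim: w d => [|[] w IHw] d //=; rewrite -addnS IHw.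
Qed.

Lemma word_blocks_cons c w : exists x k, word_blocks c w = x :: k.
Proof.
elim: w c => [|[] w IHw] c //=; first by exists c, [::].
by exists c, (word_blocks 1 w).
Qed.

Lemma word_blocks_pos c w : (0 < c)%N -> positive_entries (word_blocks c w).
Proof.
rewrite /positive_entries; elim: w c => [|[] w IHw] c c_gt0 /=; rewrite ?c_gt0 //=.
  exact: IHw.
exact: IHw.
Qed.

(** Each y in [w] stands for a comma, and replacing it by x turns that comma into a plus. The
    function [B] is arbitrary because the induction replaces it by its composite with [add_head c]
    or with prepending [c]. *)
Lemma contract_word_blocks (V : lmodType {poly rat}) (B : seq nat -> V) c w :
  \sum_(p <- x_expansion w) 'X^(p.1) *: B (word_blocks c p.2)
  = \sum_(s : (size (word_blocks c w)).-1.-tuple bool)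
      'X^(count id s) *: B (contract_seq (word_blocks c w) s).
Proof.
elim: w c B => [|l w IHw] c B.
  by rewrite big_seq1 (big_pred1 [tuple]) // => s /=; rewrite [s]tuple0; apply/esym/eqP.
case: l => /=; last by rewrite big_map IHw.
rewrite big_cat !big_map /= addrC.
have [x [k Exk]] := word_blocks_cons 1 w.
have Ek := IHw 1%N; rewrite Exk /= in Ek; rewrite Exk /=.
rewrite (big_tuple_cons _ (fun s => 'X^(count id s) *:
  B (contract_from c (x :: k) s))) /=; congr (_ + _).
  (* The first comma becomes a plus: [c] is absorbed into the first entry of what follows, at the
     cost of one factor t. *)
  transitivity ('X *: \sum_(p <- x_expansion w)
      'X^(p.1) *: B (add_head c (word_blocks 1 p.2))).
    rewrite scaler_sumr; apply: eq_bigr => p _.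
    by rewrite scalerA -exprS -word_blocksS addn1.
  rewrite (Ek (fun s => B (add_head c s))) scaler_sumr; apply: eq_bigr => s _.
  by rewrite scalerA -exprS -contract_from_add_head.
by rewrite (Ek (fun s => B (c :: s))).
Qed.

Lemma It_index_word w :
  It_index (word_index (true :: w)) =
  \sum_(p <- x_expansion w) 'X^(p.1) *: basist (word_index (true :: p.2)).
Proof.
rewrite (contract_word_blocks (fun s => basist (seq_index s)) 1 w).
rewrite /It_index /word_index /=; set s := word_blocks 1 w.
have s_pos : positive_entries s by apply: word_blocks_pos.
have E : index_seq (seq_index s) = s by rewrite /seq_index insubdK.
rewrite /dep E; apply: eq_bigr => b _; congr (_ *: basist _).
by rewrite -[LHS]seq_index_val /= E.
Qed.

Section ContractionCoefficients.
Variables (N : nat) (T : comNzRingType) (u : T) (cst : {rmorphism {poly rat} -> T})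
  (coef : nat -> {additive T -> {poly rat}}).
Hypothesis coefM : forall m p j (a : T), (m <= N)%N ->
  coef m (cst p * u ^+ j * a) = if (j <= m)%N then p * coef (m - j)%N a else 0.
Local Notation W := (word_alg T).
Local Notation y := (letter_y T).

Lemma gam_word (t : T) w : gam t (word_mon T w) =
  \sum_(p <- x_expansion w) t ^+ p.1 *: word_mon T p.2.
Proof.
elim: w => [|l w IHw].
  by rewrite big_seq1 expr0 scale1r word_mon_nil rmorph1.
rewrite word_mon_cons rmorphM /= IHw; case: l => /=.
  rewrite gam_y big_cat !big_map mulrDl /= !mulr_sumr; congr (_ + _); apply: eq_bigr => p _.
    by rewrite -scalerAr -word_mon_cons.
  by rewrite exprS -scalerAl -scalerAr scalerA -word_mon_cons.
rewrite gam_x big_map mulr_sumr; apply: eq_bigr => p _.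
by rewrite -scalerAr -word_mon_cons.
Qed.

(** The leading y opens the first entry and has no comma before it, so [gam] acts only on the
    letters after it. *)
Lemma It_word_coef m h : (m <= N)%N ->
  It (word_coef coef m (y * h)) = word_coef coef m (y * gam (cst 'X) h).
Proof.
move=> le_mN; rewrite (word_algE h) [gam _ _]linear_sum !mulr_sumr.
rewrite [in LHS](raddf_sum (word_coef coef m)) [in RHS](raddf_sum (word_coef coef m)) raddf_sum.
apply: eq_bigr => w _ /=.
rewrite -scalerAr -word_mon_cons word_coef_mon [It _]linearZ_LR /= It_basist It_index_word.
rewrite [gam _ _]linearZ_LR /= -scalerAr gam_word mulr_sumr !scaler_sumr.
rewrite (raddf_sum (word_coef coef m)) /=.
apply: eq_bigr => p _ /=.
rewrite -scalerAr -word_mon_cons !scalerA word_coef_mon mulrC; congr (_ *: _).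
have := coefM ('X^(p.1)) 0 h@_w le_mN; rewrite expr0 mulr1 subn0 /= => <-.
by rewrite rmorphXn mulrC.
Qed.
End ContractionCoefficients.

(** * Duality and admissibility in terms of words *)

Definition ab_word (ab : seq (nat * nat)) : word :=
  flatten [seq nseq p.1 true ++ nseq p.2 false | p <- ab].

Lemma index_word_cat k j : index_word (k ++ j) = index_word k ++ index_word j.
Proof. by rewrite /index_word map_cat flatten_cat. Qed.

(** The entries ({1}^(a-1), b + 1) spell y^a x^b; for a = 0 the truncated predecessor would still
    leave one y. *)
Lemma index_word_ab_index ab : all (fun p => 0 < p.1)%N ab ->
  index_word (ab_index ab) = ab_word ab.
Proof.
elim: ab => [|[a b] ab IHab] //= /andP[a_gt0 /IHab {}IHab].
rewrite /ab_index /= -/(ab_index ab) index_word_cat IHab; congr (_ ++ _).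
case: a a_gt0 => // a _ /=; elim: a => [|a IHa] /=; first by rewrite /index_word /= cats0.
by rewrite index_word_cons IHa.
Qed.

Lemma rev_negb_ab_word ab :
  rev (map negb (ab_word ab)) = ab_word [seq (p.2, p.1) | p <- rev ab].
Proof.
elim: ab => [|[a b] ab IHab] //.
rewrite /ab_word /= -/(ab_word ab) map_cat rev_cat IHab rev_cons map_rcons.
rewrite /ab_word map_rcons -cats1 flatten_cat /= cats0; congr (_ ++ _).
by rewrite map_cat rev_cat !map_nseq !rev_nseq.
Qed.

(** Reversing y^(a_1) x^(b_1) ... y^(a_s) x^(b_s) and exchanging its letters reverses the list of
    pairs and swaps each pair. *)
Lemma index_word_dual k : admissible k ->
  index_word (dual k) = rev (map negb (index_word k)).
Proof.
move=> k_adm; have ab_pos := index_ab_pos k.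
rewrite -[in RHS](index_abK k_adm) index_word_ab_index; last first.
  by apply: sub_all ab_pos => p /andP[].
rewrite rev_negb_ab_word /= index_word_ab_index //.
by rewrite all_map all_rev; apply: sub_all ab_pos => p /andP[].
Qed.

(** For a nonempty dual, the last entry is a_1 + 1 with a_1 positive. *)
Lemma admissible_dual k : admissible (dual k).
Proof.
rewrite /admissible /dual /= map_rev; have := index_ab_pos k.
case: (index_ab k) => [|[a b] ab] //= /andP[/andP[a_gt0 _] _].
rewrite rev_cons /ab_index map_rcons -cats1 flatten_cat /= cats0 last_cat last_rcons.
by rewrite ltnS a_gt0 orbT.
Qed.

Lemma admissible_oplus (k : idx) e : size e = dep k -> admissible k -> admissible (oplus k e).
Proof.
rewrite /admissible /dep /oplus /=; case: k => k /= _ sz_e.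
rewrite /oplus_seq size_map size_zip sz_e minnn => /orP[->//|k_last].
apply/orP; right; elim: k e sz_e k_last => [|x k IHk] [|n e] //= [sz_e].
case: k IHk e sz_e => [|y k] IHk [|n' e] //= sz_e; first by move=> ?; rewrite ltn_addr.
exact: (IHk (n' :: e)).
Qed.

Lemma index_word_blocks c w :
  index_word (word_blocks c.+1 w) = true :: nseq c false ++ w.
Proof.
elim: w c => [|l w IHw] c; first by rewrite /index_word /= cats0.
case: l => /=; last first.
  by rewrite IHw; congr (_ :: _); elim: (c) => //= n ->.
by rewrite index_word_cons IHw.
Qed.

Lemma last_word_blocks_rcons c w : (0 < c)%N -> (2 <= last 0 (word_blocks c (rcons w false)))%N.
Proof.
elim: w c => [|l w IHw] c c_gt0 //=; case: l => /=; last exact: IHw.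
have := IHw 1%N isT; have [x [k ->]] := word_blocks_cons 1 (rcons w false).
by [].
Qed.

(** This makes the Ohno-type relation available for every word that starts with y and ends with
    x. *)
Lemma index_word_surj w : exists2 k : idx, admissible k & index_word k = true :: rcons w false.
Proof.
exists (Index (word_blocks_pos (c := 1) (rcons w false) isT)).
  by rewrite /admissible last_word_blocks_rcons // orbT.
exact: index_word_blocks.
Qed.

Lemma index_word_nil (k : idx) : (index_seq k == [::]) = (index_word k == [::]).
Proof. by case: k => -[|x k]. Qed.

(** By [phi_tau], apply [rho] to the word of the dual index and dualise each resulting term. *)
Lemma phi_index_word (A : comNzRingType) (u : A) N (k : idx) : u ^+ N.+1 = 0 -> admissible k ->
  phi u N (word_mon A (index_word k)) =
  \sum_(m < N.+1) u ^+ m *: \sum_(e <- weak_compositions (dep (dual k)) m)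
      word_mon A (index_word (dual (oplus (dual k) e))).
Proof.
move=> u_nil k_adm.
have -> : word_mon A (index_word k) = tau (word_mon A (index_word (dual k))).
  by rewrite tau_word index_word_dual // map_rev revK -map_comp (eq_map negbK) map_id.
rewrite phi_tau rho_index_word //; last exact: index_pos.
rewrite (linear_sum (@tau A)); apply: eq_bigr => m _.
rewrite linearZ_LR (linear_sum (@tau A)); congr (_ *: _).
apply: eq_big_seq => e; rewrite mem_weak_compositions => /andP[/eqP sz_e _].
by rewrite [LHS]tau_word index_word_dual //; apply: admissible_oplus (admissible_dual k).
Qed.

(** * The Ohno-type relation on the word algebra *)

Section OhnoExtension.
Variables (N : nat) (T : comNzRingType) (u : T) (cst : {rmorphism {poly rat} -> T})
  (coef : nat -> {additive T -> {poly rat}}).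
Hypothesis u_nil : u ^+ N.+1 = 0.
Hypothesis coef1 : forall m, (m <= N)%N -> coef m 1 = (m == 0%N)%:R.
Hypothesis coefM : forall m p j (a : T), (m <= N)%N ->
  coef m (cst p * u ^+ j * a) = if (j <= m)%N then p * coef (m - j)%N a else 0.
Hypothesis coef_expand : forall a, a = \sum_(j < N.+1) cst (coef j a) * u ^+ j.
Local Notation W := (word_alg T).
Local Notation x := (letter_x T).
Local Notation y := (letter_y T).

Lemma word_coef_rho m (k : idx) : (m <= N)%N -> index_seq k != [::] ->
  word_coef coef m (rho u N (word_mon T (index_word k)))
  = \sum_(e <- weak_compositions (dep k) m) basist (oplus k e).
Proof.
move=> le_mN k_neq0; rewrite rho_index_word ?index_pos //.
rewrite (word_coef_mons coef1 coefM) //; apply: eq_big_seq => e.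
rewrite mem_weak_compositions => /andP[/eqP sz_e _].
rewrite -(index_wordK (k := oplus k e)) //=.
by rewrite -size_eq0 size_map size_zip [size e]sz_e minnn size_eq0.
Qed.

Lemma word_coef_phi m (k : idx) : (m <= N)%N -> index_seq k != [::] -> admissible k ->
  word_coef coef m (phi u N (word_mon T (index_word k)))
  = \sum_(e <- weak_compositions (dep (dual k)) m) basist (dual (oplus (dual k) e)).
Proof.
move=> le_mN k_neq0 k_adm; rewrite phi_index_word //.
rewrite (word_coef_mons coef1 coefM) //; apply: eq_big_seq => e.
rewrite mem_weak_compositions => /andP[/eqP sz_e _]; rewrite index_wordK //.
have d_adm := admissible_oplus sz_e (admissible_dual k).
rewrite index_word_nil index_word_dual // -size_eq0 size_rev size_map size_eq0.
rewrite -index_word_nil -size_eq0 size_map size_zip [size e]sz_e minnn size_eq0.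
by rewrite index_word_nil index_word_dual // -size_eq0 size_rev size_map size_eq0 -index_word_nil.
Qed.

Variables (R : lmodType rat) (Z : {linear Isp -> R}).
Hypothesis ohnoZ : ohno_type_relation Z.

HB.instance Definition _ := GRing.Linear.copy (Z_extension Z)
  (linear_extension (fun k => tensor (Z (basis k)) 1)).

Lemma Z_extension_basist k : Z_extension Z (basist k) = tensor (Z (basis k)) 1.
Proof. exact: linear_extensionU. Qed.

Lemma Z_extension_sum (I : Type) (r : seq I) (F : I -> idx) :
  Z_extension Z (\sum_(i <- r) basist (F i)) = tensor (\sum_(i <- r) Z (basis (F i))) 1.
Proof.
rewrite linear_sum /=; under eq_bigr => i _ do rewrite Z_extension_basist.
elim: r => [|i r IHr]; last by rewrite !big_cons tensorDl IHr.
by rewrite !big_nil /tensor monom0 scaler0.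
Qed.

Lemma Z_word_coef_sum m (I : Type) (r : seq I) (F : I -> W) :
  Z_extension Z (word_coef coef m (\sum_(i <- r) F i)) =
  \sum_(i <- r) Z_extension Z (word_coef coef m (F i)).
Proof. by rewrite (raddf_sum (word_coef coef m)) (linear_sum (Z_extension Z)). Qed.

Lemma Z_word_coef_scale m p j h : (m <= N)%N ->
  Z_extension Z (word_coef coef m ((cst p * u ^+ j) *: h)) =
  if (j <= m)%N then p *: Z_extension Z (word_coef coef (m - j) h) else 0.
Proof.
move=> le_mN; rewrite (word_coef_scale coefM) //.
by case: ifP => _; rewrite ?(linearZ_LR (Z_extension Z)) ?(linear0 (Z_extension Z)).
Qed.

(** By linearity [h] is a word with a coefficient in [T], which is expanded in powers of u. A factor
    u^j lowers the degree to be extracted, so the relation is used in weight m - j. *)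
Lemma ohno_word_alg m h : (m <= N)%N ->
  Z_extension Z (word_coef coef m (rho u N (y * (h * x)))) =
  Z_extension Z (word_coef coef m (phi u N (y * (h * x)))).
Proof.
move=> le_mN; rewrite (word_algE h) mulr_suml mulr_sumr.
rewrite (linear_sum (@rho T u N)) (linear_sum (@phi T u N)).
rewrite [LHS]Z_word_coef_sum [RHS]Z_word_coef_sum.
apply: eq_bigr => w _.
have [k k_adm Ek] := index_word_surj w.
have k_neq0 : index_seq k != [::] by rewrite index_word_nil Ek.
have -> : y * (h@_w *: word_mon T w * x) = h@_w *: word_mon T (index_word k).
  by rewrite Ek -scalerAl -scalerAr -word_monM -word_mon_cons cats1.
rewrite (linearZ_LR (@rho T u N)) (linearZ_LR (@phi T u N)) (coef_expand h@_w).
rewrite /= !scaler_suml [LHS]Z_word_coef_sum [RHS]Z_word_coef_sum; apply: eq_bigr => j _.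
apply: etrans (Z_word_coef_scale (coef j h@_w) j _ le_mN) _.
apply/esym/(etrans (Z_word_coef_scale (coef j h@_w) j _ le_mN)).
case: leqP => [_|_]; last by [].
have le_mjN : (m - j <= N)%N by rewrite (leq_trans (leq_subr _ _)).
apply: (congr1 (fun v => coef j h@_w *: v)).
apply: etrans (congr1 _ (word_coef_phi le_mjN k_neq0 k_adm)) _.
apply/esym/(etrans (congr1 _ (word_coef_rho le_mjN k_neq0))).
by rewrite !Z_extension_sum (ohnoZ (m - j)%N k_adm).
Qed.
End OhnoExtension.

(** * The block expansion of g_m *)

(* The increasing sequences a = c_0 < c_1 < ... < c_l = q + n with q <= c_1. *)
Fixpoint cuts (a q n : nat) : seq (seq nat) :=
  if n is n'.+1 then [seq a :: c | c <- cuts q q.+1 n'] ++ cuts a q.+1 n'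
  else [:: [:: a; q]].

Lemma sorted_ltn_last a c : path ltn a c -> (a <= last a c)%N.
Proof.
elim: c a => [|b c IHc] a //= /andP[/ltnW le_ab /IHc]; exact: leq_trans.
Qed.

Lemma mem_cuts a q n c : (a < q)%N ->
  (c \in cuts a q n) =
  [&& (1 < size c)%N, head 0%N c == a, (q <= nth 0 c 1)%N, last 0 c == (q + n)%N & sorted ltn c].
Proof.
elim: n a q c => [|n IHn] a q c lt_aq.
  rewrite inE addn0; case: c => [|a' [|b c]] //.
    by apply/eqP.
  apply/idP/idP => [/eqP[-> -> ->]|].
    by rewrite /= !eqxx leqnn lt_aq.
  move=> /and5P[_ /eqP /= -> le_qb /eqP last_c /andP[_ path_c]].
  have le_b := sorted_ltn_last path_c; rewrite last_c in le_b.
  have Eb : b = q by apply/eqP; rewrite eqn_leq le_qb le_b.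
  case: c path_c last_c {le_b} => [|d c] /=; first by rewrite Eb.
  by case/andP=> lt_bd /sorted_ltn_last le_d E; move: lt_bd; rewrite Eb -E ltnNge le_d.
rewrite mem_cat IHn ?(ltnW lt_aq) //; last by rewrite ltnS ltnW.
apply/orP/and5P => [[/mapP[c' c'_in ->]|/and5P[-> -> lt_q last_c ->]]|].
- move: c'_in; rewrite IHn // => /and5P[sz_c' head_c' le_q last_c' sorted_c'].
  case: c' sz_c' head_c' le_q last_c' sorted_c' => [|q' c'] //= _ /eqP -> _ last_c' ->.
  by rewrite eqxx leqnn lt_aq -addSnnS (eqP last_c') eqxx.
- by rewrite ltnW // -addSnnS last_c.
case: c => [|a' [|b c]]; [by case | by case |].
move=> [_ /eqP /= -> le_qb last_c /andP[lt_ab path_c]].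
have [lt_qb|le_bq] := ltnP q b.
  by right; rewrite eqxx addSnnS last_c lt_ab path_c.
left; have Eb : b = q by apply/eqP; rewrite eqn_leq le_qb le_bq.
rewrite {}Eb in last_c path_c *; apply: map_f; rewrite IHn //= eqxx addSnnS last_c path_c andbT.
case: c path_c last_c => [_ /eqP /= E|d c /= /andP[-> _]] //.
by have := leqnn q; rewrite {2}E; lia.
Qed.

Lemma cuts_uniq a q n : (a < q)%N -> uniq (cuts a q n).
Proof.
elim: n a q => [|n IHn] a q lt_aq //=.
rewrite cat_uniq (IHn a q.+1 (leqW lt_aq)) andbT map_inj_uniq ?IHn //; last by move=> c d [].
apply/hasPn => c; rewrite (mem_cuts _ _ (leqW lt_aq)) => /and5P[_ _ lt_q _ _].
apply/mapP => -[c' c'_in Ec]; move: c'_in lt_q; rewrite {}Ec mem_cuts // => /and5P[_ + _ _ _].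
by case: c' => [|b c'] //= /eqP ->; rewrite ltnn.
Qed.

Lemma size_cuts a q n c : c \in cuts a q n -> (size c <= n.+2)%N.
Proof.
elim: n a q c => [|n IHn] a q c; first by rewrite inE => /eqP ->.
rewrite mem_cat => /orP[/mapP[c' /IHn sz_c' ->]|/IHn/leqW] //.
Qed.

Lemma mem_cuts0 r c : (c \in cuts 0 1 r) = is_cuts r.+1 c.
Proof.
rewrite mem_cuts // /is_cuts add1n; case: c => [|a [|b c]] //=; first by rewrite andbC; case: eqP => // ->.
by case: eqP => //= ->; case: (0 < b)%N; rewrite ?andbF.
Qed.

(** A cut sequence in the list has between 2 and r + 2 points, so it occurs for exactly one l, its
    length minus one. *)
Lemma big_cuts (V : nmodType) r (F : seq nat -> V) :
  \sum_(1 <= l < r.+2) \sum_(c : l.+1.-tuple 'I_r.+2 | is_cuts r.+1 (map val c)) F (map val c)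
  = \sum_(c <- cuts 0 1 r) F c.
Proof.
transitivity (\sum_(1 <= l < r.+2) \sum_(c <- cuts 0 1 r | size c == l.+1) F c).
  apply: eq_big_nat => l _.
  rewrite -big_filter -[RHS]big_filter -[LHS](big_map (fun c : l.+1.-tuple 'I_r.+2 => map val c) xpredT F).
  apply: perm_big; apply: uniq_perm.
  - rewrite map_inj_uniq ?filter_uniq ?index_enum_uniq // => c d /(inj_map val_inj) E.
    exact: val_inj.
  - by rewrite filter_uniq ?cuts_uniq.
  move=> c; rewrite mem_filter mem_cuts0; apply/mapP/andP => [[d]|[/eqP sz_c c_cuts]].
    by rewrite mem_filter => /andP[d_cuts _] ->; rewrite size_map size_tuple eqxx.
  (* The sequence increases to r + 1, so all its points fit in ['I_r.+2] and [inord] does not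
     default. *)
  have c_le : map val (map (@inord r.+1) c) = c.
    rewrite -map_comp -[RHS]map_id; apply/eq_in_map => i i_in /=; rewrite inordK // ltnS.
    case/and3P: c_cuts => _ /eqP <- c_sorted; case: c i_in c_sorted {sz_c} => // a c i_in c_sorted.
    have c_leq : sorted leq (a :: c) by apply: sub_sorted c_sorted => ? ? /ltnW.
    have lt_i : (index i (a :: c) < size (a :: c))%N by rewrite index_mem.
    rewrite -nth_last -{1}(nth_index 0%N i_in).
    by apply: (sorted_leq_nth leq_trans leqnn 0%N c_leq); rewrite ?inE //= -ltnS.
  have sz_d : size (map (@inord r.+1) c) == l.+1 by rewrite size_map sz_c.
  exists (Tuple sz_d); last by rewrite /= c_le.
  by rewrite mem_filter /= c_le c_cuts mem_index_enum.
under eq_bigr => l _ do rewrite big_mkcond.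
rewrite exchange_big /=; apply: eq_big_seq => c c_in.
have sz_c := size_cuts c_in; move: c_in; rewrite mem_cuts // => /and5P[sz_c1 _ _ _ _].
rewrite (bigD1_seq (size c).-1) ?iota_uniq ?mem_index_iota //=.
rewrite prednK 1?ltnW // eqxx big1 ?addr0 // => l ne_l.
by rewrite ifN //; apply: contraNN ne_l => /eqP ->.
by case: c sz_c sz_c1 => [|? []].
Qed.

Definition cut_block (k : seq nat) (a b : nat) : nat * nat * nat :=
  ((b - a - 1)%N, (\sum_(a <= j < b) nth 0 k j)%N,
   (\sum_(a <= j < b) nth 0 (shift_first k) j)%N).

Definition cut_blocks (k c : seq nat) : seq (nat * nat * nat) :=
  [seq cut_block k (nth 0 c p) (nth 0 c p.+1) | p <- iota 0 (size c).-1].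

Lemma cut_blocks_cons k a b c :
  cut_blocks k [:: a, b & c] = cut_block k a b :: cut_blocks k (b :: c).
Proof.
by rewrite /cut_blocks /= -[1%N]/(1 + 0)%N iotaDl -map_comp.
Qed.

Lemma nth_shift_first k q : (0 < q)%N -> nth 0%N (shift_first k) q = nth 0%N k q.
Proof. by case: k q => [|x k] [|q]. Qed.

Lemma cut_block1 k q : (0 < q)%N ->
  cut_block k q q.+1 = (0, nth 0 k q, nth 0 k q)%N.
Proof. by move=> q_gt0; rewrite /cut_block !big_nat1 nth_shift_first // -subnDA addn1 subnn. Qed.

Lemma cut_blockS k a q : (a < q)%N ->
  cut_block k a q.+1 = ((cut_block k a q).1.1.+1, (cut_block k a q).1.2 + nth 0 k q,
    (cut_block k a q).2 + nth 0 k q)%N.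
Proof.
move=> lt_aq; have le_aq := ltnW lt_aq.
have Esub : (q.+1 - a - 1 = (q - a - 1).+1)%N by lia.
have q_gt0 : (0 < q)%N := leq_ltn_trans (leq0n a) lt_aq.
by rewrite /cut_block Esub !(big_nat_recr q a _ le_aq) /= nth_shift_first.
Qed.

(** Applied to the entries of a block, this supplies the bound n < k needed by [f_seriesS]. *)
Lemma leq_sum_nth k a b : all (leq 1) k -> (b <= size k)%N ->
  (b - a <= \sum_(a <= j < b) nth 0 k j)%N.
Proof.
move=> k_pos le_bk; rewrite -[(b - a)%N]muln1 -sum_nat_const_nat.
rewrite !big_nat; apply: leq_sum => j /andP[_ lt_jb]; apply: (allP k_pos).
by rewrite mem_nth // (leq_trans lt_jb).
Qed.

Lemma shift_first_pos k : all (leq 1) k -> all (leq 1) (shift_first k).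
Proof. by case: k => //= x k /andP[_ ->]. Qed.

Lemma size_shift_first k : size (shift_first k) = size k.
Proof. by case: k. Qed.

(** * Expansion of [bet] over the cut sequences *)

Section BlockExpansion.
Variables (N : nat) (T : comNzRingType) (u : T) (cst : {rmorphism {poly rat} -> T}).
Hypothesis u_nil : u ^+ N.+1 = 0.
Local Notation W := (word_alg T).
Local Notation x := (letter_x T).
Local Notation y := (letter_y T).
Local Notation t := (cst 'X).
Local Notation P := (geom_x u N).
Local Notation Q := (geom_tx t u N).
Local Notation bet := (bet t u N).
Local Notation cstP := (polyC \o cst).
Local Notation z := (u *: 'X : {poly T}).
(** Evaluation at x moves the computations inside a block to the commutative ring T[X], where [ring]
    applies. *)
Definition poly_x : {poly T} -> W := horner_alg x.
HB.instance Definition _ := GRing.RMorphism.on poly_x.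
Local Notation hx := poly_x.

Let z_nil : z ^+ N.+1 = 0.
Proof. by rewrite exprZn u_nil scale0r. Qed.

Definition f_word (n k : nat) : W := \sum_(e < N.+1) cst (f_coef n k e) *: (u *: x) ^+ e.

Lemma poly_xX : hx 'X = x. Proof. exact: horner_algX. Qed.

Lemma poly_xZ (c : T) (p : {poly T}) : hx (c%:P * p) = c *: hx p.
Proof. by rewrite rmorphM /= [hx c%:P]horner_algC mulr_algl. Qed.

Lemma f_wordE n k : f_word n k = hx (f_series cstP N z n k).
Proof.
rewrite rmorph_sum; apply: eq_bigr => e _.
rewrite rmorphM rmorphXn /= [hx _%:P]horner_algC mulr_algl; congr (_ *: _ ^+ _).
by rewrite -mul_polyC poly_xZ poly_xX.
Qed.

Lemma geom_xE : P = hx (geom N z).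
Proof. by rewrite [RHS]horner_alg_geom. Qed.

Lemma geom_txE : Q = hx (geom N (cstP 'X * z)).
Proof. by rewrite /= mul_polyC scalerA [RHS]horner_alg_geom. Qed.

Definition merge_sign : T := - (t * (1 - t)).

(* The triple (n, K, k) describes n + 1 merged entries of sum K; k is the sum of
   the same entries of [shift_first], which only differs for the first block. *)
Definition block_term (b : nat * nat * nat) : W :=
  merge_sign ^+ b.1.1 *: (y * x ^+ b.1.2.-1 * f_word b.1.1 b.2).

Lemma block_termE n K k : block_term (n, K, k) =
  merge_sign ^+ n *: (y * hx ('X^(K.-1) * f_series cstP N z n k)).
Proof. by rewrite /block_term f_wordE rmorphM rmorphXn /= poly_xX mulrA. Qed.

Lemma bet_block j : bet (word_mon T (block_word j)) = bet y * (Q * x) ^+ j.-1.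
Proof. by rewrite word_mon_block rmorphM rmorphXn /= [bet x]subst_letter. Qed.

Lemma bet_y : bet y = y * ((1 - (t * u) *: x) * P) - (t * (1 - t) * u) *: (x * x * P).
Proof. exact: subst_letter. Qed.

Lemma geom_tx_xX j : (Q * x) ^+ j = hx ((geom N (cstP 'X * z) * 'X) ^+ j).
Proof. by rewrite rmorphXn rmorphM /= poly_xX -geom_txE. Qed.

(** The weight k + 1 reflects k'_1 = k_1 + 1: the additional Q cancels the factor 1 - t u x of
    [f_series0], which leaves P Q^(k-1). *)
Lemma first_block k : (0 < k)%N -> y * P * (Q * x) ^+ k.-1 = block_term (0, k, k.+1)%N.
Proof.
case: k => // k _; rewrite block_termE expr0 scale1r f_series0 //=.
rewrite geom_xE geom_tx_xX -mulrA -rmorphM; congr (_ * hx _).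
have tz_nil : (cstP 'X * z) ^+ N.+1 = 0 by rewrite exprMn z_nil mulr0.
rewrite exprS exprMn -[LHS]mulr1 -[X in _ * X = _](geomVl tz_nil) /=; ring.
Qed.

Lemma bet_y_horner : bet y = y * hx ((1 - (t * u)%:P * 'X) * geom N z)
  - hx ((t * (1 - t) * u)%:P * ('X * 'X * geom N z)).
Proof.
have E1 : (1 - (t * u) *: x) * P = hx ((1 - (t * u)%:P * 'X) * geom N z).
  by rewrite rmorphM rmorphB rmorph1 /= poly_xZ poly_xX -geom_xE.
have E2 c : c *: (x * x * P) = hx (c%:P * ('X * 'X * geom N z)).
  by rewrite poly_xZ !rmorphM /= poly_xX -geom_xE.
by rewrite bet_y E1 E2.
Qed.

(** The term of [bet y] starting with y opens a new block, by [f_series0]. In the other term, one x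
    takes the place of the absorbed y, while u x P raises the index of f by [f_seriesS] and -t (1 -
    t) is the factor for a plus. *)
Lemma block_merge n K k j : (0 < K)%N -> (n < k)%N -> (0 < j)%N ->
  block_term (n, K, k) * bet (word_mon T (block_word j)) =
  block_term (n, K, k) * block_term (0, j, j)%N + block_term (n.+1, K + j, k + j)%N.
Proof.
case: K j => // K [] // j _ lt_nk _; rewrite bet_block bet_y_horner geom_tx_xX.
set G := geom N z; set Gt := geom N (cstP 'X * z).
have E1 : y * hx ((1 - (t * u)%:P * 'X) * G) * hx ((Gt * 'X) ^+ j) =
    block_term (0, j.+1, j.+1)%N.
  rewrite block_termE expr0 scale1r (f_series0 cstP z_nil) -mulrA -(rmorphM hx).
  apply: (congr1 (fun p => y * hx p)).
  rewrite -/G -/Gt /= exprMn -mul_polyC polyCM; ring.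
have E2 : - (block_term (n, K.+1, k) * hx ((t * (1 - t) * u)%:P * ('X * 'X * G)) * hx ((Gt * 'X) ^+ j))
    = block_term (n.+1, K.+1 + j.+1, k + j.+1)%N.
  rewrite -mulrA -(rmorphM hx) !block_termE (f_seriesS cstP z_nil _ lt_nk) -/G -/Gt.
  rewrite -scalerAl -(mulrA y) -(rmorphM hx) exprSr -scalerA -scalerN -mulrN -(rmorphN hx).
  apply: (congr1 (fun v => merge_sign ^+ n *: v)).
  rewrite scalerAr -poly_xZ; apply: (congr1 (fun p => y * hx p)).
  rewrite addSn addnS /= exprMn exprS exprD -mul_polyC /merge_sign polyCN !polyCM; ring.
apply: etrans (congr2 (fun a b => block_term (n, K.+1, k) * a + b) E1 E2).
have distr (a b c d : W) : a * ((b - c) * d) = a * (b * d) - a * c * d.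
  by rewrite mulrBl mulrBr !mulrA.
exact: distr.
Qed.

(** The block from [a] to [q] is still open. By [block_merge] the next letter y either closes it at
    [q] or extends it to q + 1, which is the recursion defining [cuts]. *)
Lemma cut_block_expansion k a q : all (leq 1) k -> (a < q)%N -> (q <= size k)%N ->
  block_term (cut_block k a q) * \prod_(j <- drop q k) bet (word_mon T (block_word j))
  = \sum_(c <- cuts a q (size k - q)) \prod_(b <- cut_blocks k c) block_term b.
Proof.
move=> k_pos; move En : (size k - q)%N => n; elim: n a q En => [|n IHn] a q En lt_aq le_qk.
  rewrite drop_oversize; last by rewrite -subn_eq0 En.
  by rewrite big_nil mulr1 big_seq1 cut_blocks_cons big_cons big_nil mulr1.
have lt_qk : (q < size k)%N by rewrite -subn_gt0 En.
have En' : (size k - q.+1 = n)%N by rewrite subnS En.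
rewrite (drop_nth 0%N lt_qk) big_cons mulrA /= big_cat big_map /=.
have kq_gt0 : (0 < nth 0 k q)%N by rewrite (allP k_pos) ?mem_nth.
have lt_seg f : all (leq 1) f -> size f = size k -> (q - a <= \sum_(a <= j < q) nth 0 f j)%N.
  by move=> f_pos sz_f; apply: leq_sum_nth; rewrite ?sz_f.
have lt_K := lt_seg k k_pos erefl.
have lt_K' := lt_seg _ (shift_first_pos k_pos) (size_shift_first k).
have q_gt0 : (0 < q)%N := leq_ltn_trans (leq0n a) lt_aq.
have merge : block_term (cut_block k a q) * bet (word_mon T (block_word (nth 0 k q)))
    = block_term (cut_block k a q) * block_term (cut_block k q q.+1)
      + block_term (cut_block k a q.+1).
  have K_gt0 : (0 < (cut_block k a q).1.2)%N.
    by apply: (leq_trans _ lt_K); rewrite subn_gt0.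
  have lt_n : ((cut_block k a q).1.1 < (cut_block k a q).2)%N.
    by apply: (leq_trans _ lt_K'); rewrite /= subn1 prednK // subn_gt0.
  rewrite (cut_blockS k lt_aq) (cut_block1 k q_gt0).
  exact: (block_merge K_gt0 lt_n kq_gt0).
have distr (b c d e : W) : (b * c + d) * e = b * (c * e) + d * e by rewrite mulrDl mulrA.
apply: etrans (congr1 (fun v => v * _) merge) _; apply: etrans (distr _ _ _ _) _.
apply: etrans (congr2 (fun v w => block_term (cut_block k a q) * v + w)
  (IHn _ _ En' (ltnSn q) lt_qk) (IHn _ _ En' (leqW lt_aq) lt_qk)) _.
apply: (congr1 (fun v : W => v + _)).
rewrite mulr_sumr; apply: eq_big_seq => c; rewrite mem_cuts // => /and5P[sz_c head_c _ _ _].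
case: c sz_c head_c => [|q' c] //= _ /eqP ->.
by rewrite cut_blocks_cons big_cons.
Qed.

Lemma prod_block_term (bs : seq (nat * nat * nat)) : all (fun b => 0 < b.1.2)%N bs ->
  \prod_(b <- bs) block_term b =
  merge_sign ^+ (\sum_(b <- bs) b.1.1) *:
  \sum_(m < N.+1) u ^+ m *: \sum_(e <- weak_compositions (size bs) m)
    cst (\prod_(be <- zip bs e) f_coef be.1.1.1 be.1.2 be.2) *:
    word_mon T (index_word (oplus_seq [seq b.1.2 | b <- bs] e)).
Proof.
move=> bs_pos.
have := @block_product T u N u_nil [seq (b.1.2, fun e => cst (f_coef b.1.1 b.2 e)) | b <- bs].
rewrite all_map => /(_ bs_pos); rewrite size_map -map_comp big_map /= => E.
transitivity (merge_sign ^+ (\sum_(b <- bs) b.1.1) *: \prod_(b <- bs)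
    (y * x ^+ b.1.2.-1 * \sum_(e < N.+1) cst (f_coef b.1.1 b.2 e) *: (u *: x) ^+ e)).
  elim: (bs) => [|b bs' IHbs]; first by rewrite !big_nil scale1r.
  by rewrite !big_cons IHbs exprD -scalerAl -scalerAr scalerA.
rewrite E; apply: (congr1 (fun v => merge_sign ^+ _ *: v)).
apply: eq_bigr => m _; apply: (congr1 (fun v => u ^+ m *: v)).
apply: eq_bigr => e _; apply: (congr1 (fun v => v *: _)).
elim: (bs) e => [|b bs' IHbs] [|e' e] /=; rewrite ?big_nil ?rmorph1 //.
by rewrite !big_cons rmorphM /= IHbs.
Qed.
End BlockExpansion.

Definition interp_sign : {poly rat} := - ('X * (1 - 'X)).

Definition g_term (m : nat) (k : idx) (c : seq nat) : Ispt :=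
  interp_sign ^+ (dep k - (size c).-1) *:
  \sum_(e <- weak_compositions (size c).-1 m)
    (\prod_(0 <= p < (size c).-1)
       f_coef (nth 0%N c p.+1 - nth 0%N c p - 1) (block_sum (shift_first k) c p) (nth 0%N e p))
    *: basist (oplus (insubd empty_index (block_sums k c)) e).

Lemma g_sumE m (k : idx) : index_seq k != [::] ->
  g_sum m k = \sum_(c <- cuts 0 1 (dep k).-1) g_term m k c.
Proof.
move=> k_neq0; rewrite /g_sum; case Er : (dep k) => [|r].
  by move: k_neq0; rewrite -size_eq0 [size _]Er.
rewrite -big_cuts; apply: eq_bigr => l _; rewrite exchange_big scaler_sumr.
apply: eq_bigr => c c_cuts.
by rewrite /g_term size_map size_tuple Er.
Qed.

Lemma block_sumsE k c : block_sums k c = [seq b.1.2 | b <- cut_blocks k c].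
Proof. by rewrite /block_sums /cut_blocks -map_comp; apply: eq_map. Qed.

(** A block of d entries contains d - 1 pluses, so the exponents of the sign add up to r - l. *)
Lemma sum_cut_blocks k c : sorted ltn c ->
  (\sum_(b <- cut_blocks k c) b.1.1 + (size c).-1 = last 0 c - head 0 c)%N.
Proof.
case: c => [|a c]; first by rewrite /cut_blocks big_nil.
elim: c a => [|b c IHc] a; first by rewrite /cut_blocks big_nil /= subnn.
rewrite cut_blocks_cons big_cons /= => /andP[lt_ab path_c].
have := IHc b path_c; have := sorted_ltn_last path_c; rewrite /=; lia.
Qed.

Lemma prod_zip_cut_blocks k c e : size e = (size c).-1 ->
  \prod_(be <- zip (cut_blocks k c) e) f_coef be.1.1.1 be.1.2 be.2 =
  \prod_(0 <= p < (size c).-1)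
     f_coef (nth 0%N c p.+1 - nth 0%N c p - 1) (block_sum (shift_first k) c p) (nth 0%N e p).
Proof.
move=> sz_e; rewrite -{1}[e](mkseq_nth 0%N) sz_e /mkseq /cut_blocks zip_map big_map.
by rewrite /index_iota subn0.
Qed.

(** A last entry of at least 2 contributes a final x. *)
Lemma index_word_admissible (k : idx) : index_seq k != [::] -> admissible k ->
  exists w, index_word k = true :: rcons w false.
Proof.
move=> k_neq0; rewrite /admissible /dep size_eq0 (negPf k_neq0) /= => k_last.
have last_k : last true (index_word k) = false.
  case: (lastP (index_seq k)) k_neq0 k_last => [//|k' n] _; rewrite last_rcons => n_gt1.
  rewrite -cats1 index_word_cat last_cat /index_word /= cats0.
  by case: n n_gt1 => [|[|n]] //= _; elim: n.
case: (index_seq k) k_neq0 last_k => [//|n k'] _; rewrite index_word_cons /=.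
by case: (lastP (_ ++ _)) => [//|w l]; rewrite last_rcons => ->; exists w.
Qed.

(** * The interpolated relation for nonempty indices *)

Section InterpolatedOhno.
Variables (N : nat) (T : comNzRingType) (u : T) (cst : {rmorphism {poly rat} -> T})
  (coef : nat -> {additive T -> {poly rat}}).
Hypothesis u_nil : u ^+ N.+1 = 0.
Hypothesis coef1 : forall m, (m <= N)%N -> coef m 1 = (m == 0%N)%:R.
Hypothesis coefM : forall m p j (a : T), (m <= N)%N ->
  coef m (cst p * u ^+ j * a) = if (j <= m)%N then p * coef (m - j)%N a else 0.
Hypothesis coef_expand : forall a, a = \sum_(j < N.+1) cst (coef j a) * u ^+ j.
Local Notation W := (word_alg T).
Local Notation x := (letter_x T).
Local Notation y := (letter_y T).
Local Notation t := (cst 'X).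
Local Notation P := (geom_x u N).
Local Notation Q := (geom_tx t u N).
Local Notation bet := (bet t u N).

Lemma word_coef_block_term m (k : idx) c : (m <= N)%N -> is_cuts (dep k) c ->
  index_seq k != [::] ->
  word_coef coef m (\prod_(b <- cut_blocks k c) block_term N u cst b) = g_term m k c.
Proof.
move=> le_mN c_cuts k_neq0; have /and3P[/eqP head_c /eqP last_c sorted_c] := c_cuts.
have sums_pos := block_sums_pos c_cuts.
have bs_pos : all (fun b => 0 < b.1.2)%N (cut_blocks k c).
  by move: sums_pos; rewrite block_sumsE /positive_entries all_map.
rewrite (prod_block_term cst u_nil bs_pos).
have -> : merge_sign cst = cst interp_sign.
  by rewrite /merge_sign /interp_sign rmorphN rmorphM rmorphB rmorph1.
rewrite scaler_sumr.
transitivity (word_coef coef m (\sum_(j < N.+1) u ^+ j *: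
    \sum_(e <- weak_compositions (size (cut_blocks k c)) j)
    cst (interp_sign ^+ (\sum_(b <- cut_blocks k c) b.1.1) *
      \prod_(be <- zip (cut_blocks k c) e) f_coef be.1.1.1 be.1.2 be.2) *:
    word_mon T (index_word (oplus_seq [seq b.1.2 | b <- cut_blocks k c] e)))).
  apply: (congr1 (word_coef coef m)); apply: eq_bigr => j _.
  rewrite scalerA mulrC -scalerA scaler_sumr; apply: (congr1 (fun v => _ *: v)).
  by apply: eq_bigr => e _; rewrite scalerA rmorphM rmorphXn.
rewrite (word_coef_series coef1 coefM) // /g_term scaler_sumr.
have sz_bs : size (cut_blocks k c) = (size c).-1 by rewrite size_map size_iota.
rewrite sz_bs; apply: eq_big_seq => e; rewrite mem_weak_compositions => /andP[/eqP sz_e _].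
have sz_c : (0 < size c)%N.
  by case: (c) last_c => // E; move: k_neq0; rewrite -size_eq0 -[size _]/(dep k) -E.
have -> : (\sum_(b <- cut_blocks k c) b.1.1 = dep k - (size c).-1)%N.
  by have := sum_cut_blocks k sorted_c; rewrite last_c head_c subn0 => <-; rewrite addnK.
rewrite scalerA prod_zip_cut_blocks //; apply: (congr1 (fun v => _ *: basist v)).
have E : index_seq (insubd empty_index (block_sums k c)) = block_sums k c by rewrite insubdK.
rewrite -(index_wordK (k := oplus _ e)) /= E ?block_sumsE //.
rewrite -size_eq0 size_map size_zip size_map sz_bs [size e]sz_e minnn.
case: (c) sz_c head_c last_c => [|a [|b c']] //= _ -> E0.
by move: k_neq0; rewrite -size_eq0 -[size _]/(dep k) -E0.
Qed.

(** The prefix y P and the x's of the first entry form the initial open block, by [first_block];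
    [cut_block_expansion] then treats the remaining entries. *)
Lemma word_coef_bet m (k : idx) : (m <= N)%N -> index_seq k != [::] ->
  word_coef coef m (y * (P * bet (word_mon T (behead (index_word k))))) = g_sum m k.
Proof.
move=> le_mN k_neq0.
rewrite g_sumE //.
transitivity (\sum_(c <- cuts 0 1 (dep k).-1)
    word_coef coef m (\prod_(b <- cut_blocks k c) block_term N u cst b)); last first.
  apply: eq_big_seq => c; rewrite mem_cuts0 prednK => [c_cuts|].
    exact: word_coef_block_term.
  by rewrite lt0n size_eq0.
rewrite -(raddf_sum (word_coef coef m)); apply: (congr1 (word_coef coef m)).
have k_pos : all (leq 1) k := index_pos k.
have k_gt0 : (0 < size k)%N by rewrite lt0n size_eq0.
rewrite -[(dep k).-1]subn1 -(cut_block_expansion cst u_nil k_pos) //.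
case: k k_neq0 k_pos k_gt0 => [[//|k0 k] k_pos] _ /andP[k0_gt0 _] _.
rewrite [index_seq _]/= [drop _ _]/= drop0.
have -> : cut_block (k0 :: k) 0 1 = (0, k0, k0.+1)%N by rewrite /cut_block !big_nat1.
rewrite -first_block // index_word_cons /= word_monM rmorphM word_mon_nseq_x rmorphXn /= !mulrA.
rewrite [bet x]subst_letter; apply: (congr1 (fun v => _ * v)).
elim: k {k_pos} => [|j k IHk]; first by rewrite big_nil word_mon_nil rmorph1.
by rewrite index_word_cons word_monM rmorphM big_cons -IHk.
Qed.

Variables (R : lmodType rat) (Z : {linear Isp -> R}).
Hypothesis ohnoZ : ohno_type_relation Z.

Lemma interpolated_ohno m (k : idx) : (m <= N)%N -> index_seq k != [::] -> admissible k ->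
  Zt Z (g_sum m k) =
  \sum_(e <- weak_compositions (dep (dual k)) m) Zt Z (basist (dual (oplus (dual k) e))).
Proof.
move=> le_mN k_neq0 k_adm.
have [w Ew] := index_word_admissible k_neq0 k_adm.
set h := word_mon T (rcons w false).
(* Since [alp] sends the final x of [h] to Q x, the word sums in [y * alp h] again end in x, as
   [ohno_word_alg] requires. *)
have alp_h : alp t u N h = alp t u N (word_mon T w) * Q * x.
  by rewrite /h -cats1 word_monM rmorphM /= [alp t u N x]alp_x mulrA.
have gam_h : y * gam t (P * bet h) = rho u N (y * (alp t u N (word_mon T w) * Q * x)).
  by rewrite -alp_h (rmorphM (gam t)) (rmorphM (rho u N)) /= rho_y gam_geom mulrA (rho_alp t u_nil).
have phi_h : phi u N (y * (alp t u N (word_mon T w) * Q * x)) = y * gam t (phi u N h).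
  by rewrite -alp_h rmorphM /= phi_y phi_alp.
have phi_k : y * phi u N h = phi u N (word_mon T (index_word k)).
  by rewrite Ew word_mon_cons (rmorphM (phi u N)) /= [phi u N (word_mon T [:: true])]phi_y.
have bet_h : word_coef coef m (y * (P * bet h)) = g_sum m k.
  by rewrite -(word_coef_bet le_mN k_neq0) Ew.
rewrite -bet_h /Zt /=.
(* The chain applies I^t, passes from [gam bet] to [rho alp], exchanges [rho] for [phi] under Z,
   passes from [phi alp] to [gam phi], and reads off I^t again. *)
apply: etrans (congr1 (Z_extension Z) (It_word_coef coefM (P * bet h) le_mN)) _.
apply: etrans (congr1 (fun v => Z_extension Z (word_coef coef m v)) gam_h) _.
apply: etrans (ohno_word_alg u_nil coef1 coefM coef_expand ohnoZ _ le_mN) _.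
apply: etrans (congr1 (fun v => Z_extension Z (word_coef coef m v)) phi_h) _.
apply: etrans (esym (congr1 (Z_extension Z) (It_word_coef coefM (phi u N h) le_mN))) _.
apply: etrans (congr1 (fun v => Z_extension Z (It (word_coef coef m v))) phi_k) _.
rewrite (word_coef_phi u_nil coef1 coefM le_mN k_neq0 k_adm).
rewrite (linear_sum It); exact: (linear_sum (linear_extension (fun k => tensor (Z (basis k)) 1))).
Qed.
End InterpolatedOhno.

Theorem mainTheorem1 (R : lmodType rat) (Z : {linear Isp -> R})
    (ohnoZ : ohno_type_relation Z) (k : idx) (k_adm : admissible k) (m : nat) :
  Zt Z (g_sum m k)
  = \sum_(e <- weak_compositions (dep (dual k)) m)
      Zt Z (basist (dual (oplus (dual k) e))).
Proof.
(* The empty index is not a value of [word_index] and is treated directly: both sides are the value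
   at the empty index if m = 0, and zero otherwise. *)
have [k_nil|k_neq0] := eqVneq (index_seq k) [::].
  have -> : k = empty_index by apply: val_inj.
  have -> : g_sum m empty_index = (m == 0%N)%:R *: basist empty_index by [].
  have -> : dep (dual empty_index) = 0%N by [].
  case: m => [|m]; last first.
    by rewrite scale0r big_nil /Zt /= /It /Z_extension !linear0.
  by rewrite scale1r big_seq1; congr (Zt Z (basist _)); apply: val_inj.
(* Only the coefficient of u^m is compared, so truncation at N = m suffices. *)
exact: (interpolated_ohno (@trunc_var_nil m) (@trunc_coef1 m) (@trunc_coefM m) (@trunc_expand m)).
Qed.
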